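(* Let $n\ge3$ and let $CL_n$ be the circular ladder graph. The total cut complex $\Delta_{n-1}^t(CL_n)$ (which is $n$-dimensional) is homotopy equivalent to a wedge of $n-1$ copies of $\mathbb{S}^2$ if $n$ is odd, and to a wedge of $(n-1)^2$ copies of $\mathbb{S}^2$ if $n$ is even.
   Context: The circular ladder graph $CL_n$ has $2n$ vertices $\{i^+,i^-:1\le i\le n\}$ and edges $i^+(i+1)^+$, $i^-(i+1)^-$ and $i^+i^-$ for $1\le i\le n$, indices modulo $n$. For a graph $G=(V,E)$, the total cut complex $\Delta_k^t(G)$ is the simplicial complex whose facets are the sets $V\setminus S$ for $S$ an independent set of size $k$ in $G$. *)

(* Defs.v *)
From HB Require Import structures.
From mathcomp Require Import all_boot all_order all_algebra.
From mathcomp Require Import all_classical all_reals all_analysis.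
From mathcomp Require Import homotopy.

Set Implicit Arguments.
Unset Strict Implicit.
Unset Printing Implicit Defensive.

Import Order.TTheory GRing.Theory Num.Theory.
Import numFieldNormedType.Exports.

Local Open Scope classical_set_scope.
Local Open Scope ring_scope.

(* The vertices i^+ and i^- are (i, true) and (i, false); [ordS] is the
   successor modulo n. For n >= 3 this relation is a simple graph. *)
Definition circular_ladder (n : nat) : rel ('I_n * bool) :=
  fun u v =>
    (u.2 == v.2) && ((v.1 == ordS u.1) || (u.1 == ordS v.1)) ||
    (u.1 == v.1) && (u.2 != v.2).

Definition independent (V : finType) (e : rel V) (S : {set V}) : bool :=
  [forall u in S, forall v in S, ~~ e u v].

(* An abstract simplicial complex on V is given by the set of its faces,
   the empty face included. *)
Definition complex_of_facets (V : finType) (F : {set {set V}}) : {set {set V}} :=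
  [set s : {set V} | [exists t in F, s \subset t]].

Definition total_cut_complex (V : finType) (e : rel V) (k : nat) :
    {set {set V}} :=
  complex_of_facets
    [set ~: S | S in [set S : {set V} | independent e S && (#|S| == k)]%SET].

(* Only meaningful for a complex with a nonempty face. *)
Definition complex_dim (V : finType) (K : {set {set V}}) : nat :=
  (\max_(s in K) #|s|).-1.

(* The points of |K| are given by their barycentric coordinates. As V is finite,
   the topology of |K| is the one induced by the product topology on R^V. *)
Definition realization_set (R : realType) (V : finType) (K : {set {set V}}) :
    set (prod_topology (fun _ : V => R : topologicalType)) :=
  [set x | [/\ forall v, 0 <= x v, \sum_v x v = 1
             & [set v | x v != 0]%SET \in K]].

Definition realization (R : realType) (V : finType) (K : {set {set V}}) :
    topologicalType :=
  set_type (@realization_set R V K).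

Definition sphere (R : realType) (d : nat) : set 'rV[R]_d.+1 :=
  [set x | \sum_i x ord0 i ^+ 2 = 1].

Lemma sphere_delta (R : realType) (d : nat) :
  sphere (delta_mx ord0 ord0 : 'rV[R]_d.+1).
Proof.
rewrite /sphere /= big_ord_recl big1 => [|i _]; rewrite !mxE ?eqxx /=.
  by rewrite expr1n addr0.
by rewrite expr0n.
Qed.

Definition sphere_point (R : realType) (d : nat) : set_type (@sphere R d) :=
  SigSub (mem_set (sphere_delta R d)).

(* With the library's [wedge] this is the empty space, not a point, if m = 0. *)
Definition wedge_of_spheres (R : realType) (d m : nat) : topologicalType :=
  wedge (fun _ : 'I_m => sphere_point R d).

Definition homotopic (R : realType) (X Y : topologicalType) (f g : X -> Y) :
    Prop :=
  exists H : X * R -> Y,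
    [/\ {within [set: X] `*` `[0, 1], continuous H},
        forall x, H (x, 0) = f x
      & forall x, H (x, 1) = g x].

Definition homotopy_equivalent (R : realType) (X Y : topologicalType) : Prop :=
  exists (f : X -> Y) (g : Y -> X),
    [/\ continuous f, continuous g,
        homotopic R (g \o f) id & homotopic R (f \o g) id].

(* Main.v *)
Require Import Defs.
From HB Require Import structures.
From mathcomp Require Import all_boot all_order all_algebra.
From mathcomp Require Import all_classical all_reals all_analysis.
From mathcomp Require Import homotopy.
From mathcomp Require Import ring lra.

(** Separate the vertices into two sides by the parity of the rung and the sign.
    For even n, the faces of the complex are the sets with at most one vertex on
    one of the sides; for odd n, they are the sets all of whose vertices on one
    side lie weakly below those on the other side. Both complexes are unions of
    two cones, so they are homotopy equivalent to the suspension of the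
    intersection M of the cones: decompose a point along the level sets of its
    barycentric coordinates, and send the level sets outside M to the apices.

    For even n, M is the complete bipartite graph on the two sides; for odd n, it
    consists of two simplices joined by the n rungs. Let E be the set of the edges
    of M from one side to the other that avoid the rung 0: there are (n - 1)^2 of
    them for even n, and n - 1 for odd n. They are facets of M, and deleting them
    leaves a contractible complex. Hence the suspension without the triangles
    joining E to one of the apices is a union of two cones that meet in a
    contractible complex, so it is contractible. Finally, if the complement of a
    set of open d-dimensional facets is contractible, then a complex is homotopy
    equivalent to its quotient by this complement, which is by stereographic
    projection a wedge of d-spheres, one for each facet. *)

Set Implicit Arguments.
Unset Strict Implicit.
Unset Printing Implicit Defensive.
Import Order.TTheory GRing.Theory Num.Theory.
Import numFieldNormedType.Exports.
Local Open Scope classical_set_scope.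
Local Open Scope ring_scope.

(** * Continuity *)

Lemma comp_continuous (X Y Z : topologicalType) (f : X -> Y) (g : Y -> Z) :
  continuous f -> continuous g -> continuous (fun x => g (f x)).
Proof. by move=> cf cg x; apply: continuous_comp; [exact: cf|exact: cg]. Qed.

Lemma pair_continuous (X Y Z : topologicalType) (f : X -> Y) (g : X -> Z) :
  continuous f -> continuous g -> continuous (fun x => (f x, g x)).
Proof. by move=> cf cg x; apply: cvg_pair; [exact: cf|exact: cg]. Qed.

Lemma fst_continuous (X Y : topologicalType) : continuous (@fst X Y).
Proof. by move=> z; exact: cvg_fst. Qed.

Lemma snd_continuous (X Y : topologicalType) : continuous (@snd X Y).
Proof. by move=> z; exact: cvg_snd. Qed.

Section RealFunctions.
Context {R : realType} {X : topologicalType}.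
Implicit Types f g : X -> R.

Lemma add_fun_continuous f g :
  continuous f -> continuous g -> continuous (fun x => f x + g x).
Proof. by move=> cf cg x; apply: cvgD; [exact: cf|exact: cg]. Qed.

Lemma sub_fun_continuous f g :
  continuous f -> continuous g -> continuous (fun x => f x - g x).
Proof. by move=> cf cg x; apply: cvgB; [exact: cf|exact: cg]. Qed.

Lemma mul_fun_continuous f g :
  continuous f -> continuous g -> continuous (fun x => f x * g x).
Proof. by move=> cf cg x; apply: cvgM; [exact: cf|exact: cg]. Qed.

Lemma inv_fun_continuous f :
  (forall x, f x != 0) -> continuous f -> continuous (fun x => (f x)^-1).
Proof. by move=> f0 cf x; apply: cvgV => //; exact: cf. Qed.

Lemma sum_fun_continuous (I : finType) (P : pred I) (f : I -> X -> R) :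
  (forall i, P i -> continuous (f i)) ->
  continuous (fun x => \sum_(i | P i) f i x).
Proof. by move=> cf; apply: continuous_big => //; exact: add_continuous. Qed.

Lemma bigmin_fun_continuous (I : finType) (P : pred I) (a : X -> R) (f : I -> X -> R) :
  continuous a -> (forall i, P i -> continuous (f i)) ->
  continuous (fun x => \big[Num.min/a x]_(i | P i) f i x).
Proof.
move=> ca cf; rewrite unlock; elim: (index_enum I) => //= i r IH.
by case Pi: (P i) => //; apply: min_fun_continuous => //; exact: cf.
Qed.

Lemma bigmax_fun_continuous (I : finType) (P : pred I) (a : R) (f : I -> X -> R) :
  (forall i, P i -> continuous (f i)) ->
  continuous (fun x => \big[Num.max/a]_(i | P i) f i x).
Proof. by move=> cf; apply: continuous_big => //; exact: max_continuous. Qed.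

End RealFunctions.

Lemma closed_cover_continuous (X Y : topologicalType) (I : finType)
    (C : I -> set X) (f : X -> Y) :
  (forall i, closed (C i)) -> (forall x, exists i, C i x) ->
  (forall i, {within C i, continuous f}) -> continuous f.
Proof.
move=> cC cover cf; apply/continuous_closedP => D cD.
have /choice[E HE] i : exists E, closed E /\ E `&` C i = f @^-1` D `&` C i.
  have [E cE EE] : exists2 E, closed E & E `&` C i = f @^-1` D `&` C i.
    by apply/closed_subspaceP; move/continuous_closedP: (cf i); exact.
  by exists E.
rewrite (_ : f @^-1` D = \bigcup_(i in [set: I]) (E i `&` C i)).
  apply: closed_bigcup => [|i _]; first exact: finite_finset.
  by apply: closedI => //; have [] := HE i.
apply/seteqP; split => [x Dx|x [i _]].
  by have [i Cx] := cover x; exists i => //; rewrite (HE i).2.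
by rewrite (HE i).2 => -[].
Qed.

Lemma eq_in_within_continuous (X Y : topologicalType) (C : set X) (f F : X -> Y) :
  (forall x, C x -> F x = f x) -> continuous F -> {within C, continuous f}.
Proof.
move=> Ff cF; apply: (@subspace_eq_continuous _ C _ F) => [x /set_mem|].
  exact: Ff.
exact: continuous_subspaceT.
Qed.

Lemma closed_pasting (X Y : topologicalType) (A B : set X) (f : set_type A -> Y)
    (g : X -> Y) :
  closed A -> closed B -> (forall x, A x \/ B x) -> continuous f -> continuous g ->
  (forall x (Ax : A x), B x -> f (SigSub (mem_set Ax)) = g x) ->
  exists h : X -> Y, [/\ continuous h,
    forall x (Ax : A x), h x = f (SigSub (mem_set Ax)) & forall x, B x -> h x = g x].
Proof.
move=> cA cB cover cf cg fg.
pose h x := if pselect (A x) is left Ax then f (SigSub (mem_set Ax)) else g x.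
have hA x (Ax : A x) : h x = f (SigSub (mem_set Ax)).
  by rewrite /h; case: pselect => // Ax'; congr f; exact: val_inj.
have hB x : B x -> h x = g x by rewrite /h; case: pselect => // Ax; exact: fg.
exists h; split => //.
apply: (@closed_cover_continuous _ _ _ (fun b : bool => if b then A else B)).
- by case.
- by move=> x; case: (cover x); [exists true|exists false].
- case; last by apply: eq_in_within_continuous cg => x /hB.
  apply/subspace_sigL_continuousP; rewrite (_ : sigL A h = f)//.
  by apply/funext => z; rewrite /sigL /= (hA _ (set_valP z)); congr f; exact: val_inj.
Qed.

Definition clamp01 (R : realType) (t : R) : R := Num.max 0 (Num.min 1 t).

Section Clamp.
Context {R : realType}.
Implicit Types t : R.

Lemma clamp01_itv t : clamp01 t \in `[0, 1].
Proof. by rewrite in_itv /= /clamp01 le_max lexx ge_max ler01 ge_min lexx. Qed.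

Lemma clamp01_le0 t : t <= 0 -> clamp01 t = 0.
Proof. by move=> t0; rewrite /clamp01 min_r ?max_l// (le_trans t0). Qed.

Lemma clamp01_ge1 t : 1 <= t -> clamp01 t = 1.
Proof. by move=> t1; rewrite /clamp01 min_l// max_r. Qed.

Lemma clamp01_continuous : continuous (@clamp01 R).
Proof.
apply: max_fun_continuous; first exact: cst_continuous.
by apply: min_fun_continuous; [exact: cst_continuous|move=> t; exact: cvg_id].
Qed.

End Clamp.

(** * Homotopies of maps of pairs *)

(* The parameter of the homotopy ranges over the whole line rather than [0, 1]:
   this is no restriction, as time can be clamped. *)
Definition homotopic_pair (R : realType) (X Y : topologicalType) (A : set X)
    (B : set Y) (f g : X -> Y) : Prop :=
  exists H : X * R -> Y,
    [/\ continuous H, forall x, H (x, 0) = f x, forall x, H (x, 1) = g x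
      & forall x t, A x -> B (H (x, t))].

Definition contractible (R : realType) (X : topologicalType) : Prop :=
  exists x0 : X, homotopic R id (fun _ : X => x0).

Section Homotopy.
Context {R : realType}.

Lemma clamp_time_continuous (X Y : topologicalType) (H : X * R -> Y) :
  {within [set: X] `*` `[0, 1], continuous H} ->
  continuous (fun z : X * R => H (z.1, clamp01 z.2)).
Proof.
move=> /subspace_sigL_continuousP cH.
have c01 (z : X * R) : ([set: X] `*` `[0, 1]) (z.1, clamp01 z.2).
  by split => //=; exact: clamp01_itv.
pose c z : set_type ([set: X] `*` `[0, 1]) := SigSub (mem_set (c01 z)).
suff cc : continuous c by exact: comp_continuous cc cH.
apply: continuous_comp_initial; apply: pair_continuous.
  exact: fst_continuous.
exact: comp_continuous (@snd_continuous _ _) clamp01_continuous.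
Qed.

Lemma homotopicP (X Y : topologicalType) (f g : X -> Y) :
  homotopic R f g <-> homotopic_pair R setT setT f g.
Proof.
split=> [[H [cH H0 H1]]|[H [cH H0 H1 _]]]; last first.
  by exists H; split => //; exact: continuous_subspaceT.
exists (fun z => H (z.1, clamp01 z.2)); split => //.
- exact: clamp_time_continuous.
- by move=> x; rewrite clamp01_le0.
- by move=> x; rewrite clamp01_ge1.
Qed.

Lemma homotopic_pair_sym (X Y : topologicalType) (A : set X) (B : set Y)
    (f g : X -> Y) : homotopic_pair R A B f g -> homotopic_pair R A B g f.
Proof.
move=> [H [cH H0 H1 HAB]]; exists (fun z => H (z.1, 1 - z.2)); split.
- apply: (@comp_continuous _ _ _ (fun z : X * R => (z.1, 1 - z.2)) H) => //.
  apply: pair_continuous; first exact: fst_continuous.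
  by apply: sub_fun_continuous; [exact: cst_continuous|exact: snd_continuous].
- by move=> x; rewrite subr0.
- by move=> x; rewrite subrr.
- by move=> x t; exact: HAB.
Qed.

Lemma homotopic_pair_trans (X Y : topologicalType) (A : set X) (B : set Y)
    (f g h : X -> Y) : homotopic_pair R A B f g -> homotopic_pair R A B g h ->
  homotopic_pair R A B f h.
Proof.
move=> [F [cF F0 F1 FAB]] [G [cG G0 G1 GAB]].
pose early (z : X * R) := F (z.1, clamp01 (2 * z.2)).
pose late (z : X * R) := G (z.1, clamp01 (2 * z.2 - 1)).
have reparam_continuous (K : X * R -> Y) (u : R -> R) : continuous K ->
    continuous u -> continuous (fun z : X * R => K (z.1, clamp01 (u z.2))).
  move=> cK cu; apply: comp_continuous cK; apply: pair_continuous.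
    exact: fst_continuous.
  apply: comp_continuous clamp01_continuous.
  exact: comp_continuous (@snd_continuous _ _) cu.
have double_continuous : continuous (fun t : R => 2 * t).
  by move=> t; apply: cvgM; [exact: cvg_cst|exact: cvg_id].
pose lower : set (X * R) := snd @^-1` [set t | t <= 2^-1].
pose upper : set (X * R) := snd @^-1` [set t | 2^-1 <= t].
have [|||||z z_lo z_up|H [cH Hlo Hup]] :=
    @closed_pasting _ _ lower upper (early \o set_val) late.
- by apply: preimage_closed => [z _|]; [exact: cvg_snd|exact: closed_le].
- by apply: preimage_closed => [z _|]; [exact: cvg_snd|exact: closed_ge].
- by move=> z; case: (leP z.2 2^-1) => [?|/ltW ?]; [left|right].
- apply: (@comp_continuous _ _ _ set_val early); first exact: initial_continuous.
  exact: reparam_continuous.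
- apply: (@reparam_continuous G (fun t => 2 * t - 1)) => //.
  by apply: sub_fun_continuous => //; exact: cst_continuous.
- have z2 : z.2 = 2^-1 by apply/le_anti/andP.
  by rewrite /early /late /= z2 mulfV// subrr clamp01_ge1// clamp01_le0// F1 G0.
exists H; split => // [x|x|x t Ax].
- have x0 : lower (x, 0) by rewrite /lower /= invr_ge0 ler0n.
  by rewrite (Hlo _ x0) /early /= mulr0 clamp01_le0// F0.
- rewrite Hup; first by rewrite /late /= mulr1 clamp01_ge1 ?G1//; lra.
  by rewrite /upper /=; lra.
- have [xt|/ltW xt] := leP t 2^-1.
    by rewrite (Hlo (x, t) xt); exact: FAB.
  by rewrite Hup//; exact: GAB.
Qed.

Lemma homotopic_trans (X Y : topologicalType) (f g h : X -> Y) :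
  homotopic R f g -> homotopic R g h -> homotopic R f h.
Proof.
move=> /homotopicP fg /homotopicP gh; apply/homotopicP.
exact: homotopic_pair_trans fg gh.
Qed.

Lemma homotopic_sym (X Y : topologicalType) (f g : X -> Y) :
  homotopic R f g -> homotopic R g f.
Proof. by move=> /homotopicP fg; exact/homotopicP/homotopic_pair_sym. Qed.

Lemma homotopic_comp (X Y Z W : topologicalType) (f g : Y -> Z)
    (u : X -> Y) (v : Z -> W) : continuous u -> continuous v ->
  homotopic R f g -> homotopic R (v \o f \o u) (v \o g \o u).
Proof.
move=> cu cv /homotopicP[H [cH H0 H1 _]]; apply/homotopicP.
exists (fun z => v (H (u z.1, z.2))); split => // [|x|x] /=; rewrite ?H0 ?H1//.
apply: comp_continuous cv; apply: comp_continuous cH.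
apply: pair_continuous; last exact: snd_continuous.
exact: comp_continuous (@fst_continuous _ _) cu.
Qed.

Lemma homotopy_equivalent_trans (X Y Z : topologicalType) :
  homotopy_equivalent R X Y -> homotopy_equivalent R Y Z ->
  homotopy_equivalent R X Z.
Proof.
move=> [f [g [cf cg gf fg]]] [f' [g' [cf' cg' gf' fg']]].
exists (f' \o f), (g \o g'); split.
- exact: comp_continuous cf cf'.
- exact: comp_continuous cg' cg.
- exact: homotopic_trans (homotopic_comp cf cg gf') gf.
- exact: homotopic_trans (homotopic_comp cg' cf' fg) fg'.
Qed.

Lemma homotopy_equivalent_contractible (X Y : topologicalType) :
  homotopy_equivalent R X Y -> contractible R Y -> contractible R X.
Proof.
move=> [f [g [cf cg gf _]]] [y0 y0P]; exists (g y0).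
exact: homotopic_trans (homotopic_sym gf) (homotopic_comp cf cg y0P).
Qed.

End Homotopy.

(* The factor [1 - depth x / r] stops the homotopy where it has to fit with the
   constant one. *)
Lemma damped_homotopy_extension (R : realType) (X Y Z : topologicalType)
    (depth : X -> R) (r : R) (near : set_type [set x | depth x <= r] -> Z)
    (C : Z * R -> Y) (rho : X -> Y) :
  0 < r -> continuous depth -> continuous near -> continuous C -> continuous rho ->
  (forall x, C (near x, 0) = rho (set_val x)) ->
  exists G : X * R -> Y, [/\ continuous G, forall x, G (x, 0) = rho x
    & forall x (xr : [set x | depth x <= r] x) t,
        G (x, t) = C (near (SigSub (mem_set xr)), t * (1 - depth x / r))].
Proof.
move=> r0 cdepth cnear cC crho C0; pose N := [set x | depth x <= r].
have cdepth1 : continuous (fun z : X * R => depth z.1).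
  exact: comp_continuous (@fst_continuous _ _) cdepth.
pose S : set (X * R) := (fun z => depth z.1) @^-1` [set t | t <= r].
have csval : continuous (set_val : S -> X * R) by exact: initial_continuous.
pose base (z : S) : set_type N := SigSub (mem_set (set_valP z : N (set_val z).1)).
pose slowed (z : X * R) := z.2 * (1 - depth z.1 / r).
have [|||||z Sz z_far|G [cG GS Gfar]] := @closed_pasting _ _ S
    ((fun z => depth z.1) @^-1` [set t | r <= t])
    (fun z => C (near (base z), slowed (set_val z))) (fun z => rho z.1).
- by apply: preimage_closed => [z _|]; [exact: cdepth1|exact: closed_le].
- by apply: preimage_closed => [z _|]; [exact: cdepth1|exact: closed_ge].
- by move=> z; case: (leP (depth z.1) r) => [?|/ltW ?]; [left|right].
- apply: comp_continuous cC; apply: pair_continuous.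
    apply: comp_continuous cnear; apply: continuous_comp_initial.
    exact: comp_continuous csval (@fst_continuous _ _).
  apply: (@comp_continuous _ _ _ _ slowed csval).
  apply: mul_fun_continuous; first exact: snd_continuous.
  apply: sub_fun_continuous; first exact: cst_continuous.
  by apply: mul_fun_continuous => //; exact: cst_continuous.
- exact: comp_continuous (@fst_continuous _ _) crho.
- have depth_r : depth z.1 = r by apply/le_anti/andP.
  by rewrite /slowed set_valE /= depth_r mulfV ?gt_eqF// subrr mulr0 C0.
have GE x (xr : N x) t : G (x, t) = C (near (SigSub (mem_set xr)), t * (1 - depth x / r)).
  by rewrite (GS (x, t) xr) /slowed set_valE /=; congr (C (near _, _)); exact: val_inj.
exists G; split => // x; have [xr|/ltW xr] := leP (depth x) r; last exact: Gfar.
by rewrite (GE x xr) mul0r C0.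
Qed.

(** * Quotients of compact spaces *)

Lemma cluster_continuous (X Y : topologicalType) (f : X -> Y) (x y : X) :
  continuous f -> cluster (nbhs x) y -> cluster (nbhs (f x)) (f y).
Proof.
move=> cf clxy A B /cf nA /cf nB.
by have [z [Az Bz]] := clxy _ _ nA nB; exists (f z).
Qed.

Lemma prod_hausdorff (X Y : topologicalType) :
  hausdorff_space X -> hausdorff_space Y -> hausdorff_space (X * Y)%type.
Proof.
move=> hX hY [x y] [x' y'] cl; congr pair.
  exact: hX (cluster_continuous (@fst_continuous _ _) cl).
exact: hY (cluster_continuous (@snd_continuous _ _) cl).
Qed.

Lemma set_type_hausdorff (X : topologicalType) (A : set X) :
  hausdorff_space X -> hausdorff_space (set_type A).
Proof.
move=> hX x y cl; apply/val_inj/hX.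
exact: cluster_continuous (@initial_continuous _ _ (set_val : A -> X)) cl.
Qed.

Lemma set_type_compact (X : topologicalType) (A : set X) :
  compact A -> compact [set: set_type A].
Proof.
move=> cA F PF _; have PG : ProperFilter ((set_val : A -> X) @ F).
  exact: fmap_proper_filter.
have GA : ((set_val : A -> X) @ F) A.
  by apply: (@filterS _ F _ setT _ _ filterT) => x _; exact: set_valP.
have [p [Ap clp]] := cA _ PG GA.
exists (SigSub (mem_set Ap)); split => // B U FB [_ [[W oW <-] Wp WU]].
have [||y [[x Bx <-] Wx]] := clp (set_val @` B) W.
- by apply: (@filterS _ F _ B _ _ FB) => x Bx; exists x.
- exact: open_nbhs_nbhs.
by exists x; split => //; exact: WU.
Qed.

Lemma compact_image_within_continuous (Z Y W : topologicalType) (S : set Z)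
    (q : Z -> Y) (F : Y -> W) :
  compact S -> hausdorff_space Y -> continuous q -> continuous (F \o q) ->
  {within q @` S, continuous F}.
Proof.
move=> cS hY cq cFq; apply/continuous_closedP => D cD.
apply/closed_subspaceP; exists (q @` (S `&` (F \o q) @^-1` D)).
  apply: compact_closed => //; apply: continuous_compact.
    exact: continuous_subspaceT.
  by apply: compact_closedI => //; move/continuous_closedP: cFq; exact.
apply/seteqP; split => y.
  by move=> [[z [Sz Dz] <-] _]; split => //; exists z.
by move=> [Dy [z Sz zy]]; rewrite -zy in Dy *; split; exists z.
Qed.

Section CompactQuotient.
Context {R : realType} {X Y : topologicalType} (q : X -> Y) (s : Y -> X).
Hypotheses (compactX : compact [set: X]) (hausdorffY : hausdorff_space Y).
Hypotheses (cq : continuous q) (sK : cancel s q).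

Lemma compact_quotient_continuous (W : topologicalType) (F : Y -> W) :
  continuous (F \o q) -> continuous F.
Proof.
move=> cFq; apply/continuous_subspace_setT.
have <- : q @` setT = setT by apply/seteqP; split=> // y _; exists (s y).
exact: compact_image_within_continuous.
Qed.

Lemma compact_quotient_homotopic (W : topologicalType) (H : X * R -> W) :
  continuous H -> (forall x t, H (s (q x), t) = H (x, t)) ->
  homotopic R (fun y => H (s y, 0)) (fun y => H (s y, 1)).
Proof.
move=> cH Hq; exists (fun z => H (s z.1, z.2)); split=> //.
pose q1 (z : X * R) := (q z.1, z.2).
rewrite (_ : _ `*` _ = q1 @` (setT `*` `[0, 1])); last first.
  apply/seteqP; split => [[y t] [_ t01]|_ [[x t] [_ t01] <-]//].
  by exists (s y, t) => //; rewrite /q1 /= sK.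
apply: compact_image_within_continuous.
- by apply: compact_setX => //; exact: segment_compact.
- by apply: prod_hausdorff => //; exact: Rhausdorff.
- apply: pair_continuous (@snd_continuous _ _).
  exact: comp_continuous (@fst_continuous _ _) cq.
- by rewrite (_ : _ \o q1 = H)//; apply/funext => -[x t] /=; exact: Hq.
Qed.

End CompactQuotient.

(* [q] exhibits [Y] as the quotient X/A. The homotopy descends along [q] and its
   end map factors through [q], which gives the homotopy inverse. *)
Lemma quotient_homotopy_equivalent (R : realType) (X Y : topologicalType)
    (A : set X) (q : X -> Y) (e : X -> X) :
  compact [set: X] -> hausdorff_space Y -> continuous q ->
  (forall y, exists x, q x = y) ->
  (forall x x', q x = q x' <-> x = x' \/ A x /\ A x') ->
  homotopic_pair R A A id e -> (forall x x', A x -> A x' -> e x = e x') ->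
  homotopy_equivalent R X Y.
Proof.
move=> cX hY cq q_surj qE [H [cH H0 H1 HA]] eA.
have /choice[s sK] := q_surj.
have e_section : (e \o s) \o q = e.
  apply/funext => x /=; have /qE[->//|[As Ax]] := sK (q x); exact: eA.
have ce : continuous e.
  rewrite (_ : e = fun x => H (x, 1)); last by apply/funext => x; rewrite H1.
  apply: (@comp_continuous _ _ _ (fun x : X => (x, 1 : R))) => //.
  by apply: pair_continuous => x; [exact: cvg_id|exact: cvg_cst].
exists q, (e \o s); split => //.
- by apply: (compact_quotient_continuous cX hY cq sK); rewrite e_section.
- by rewrite e_section; apply/homotopic_sym/homotopicP; exists H; split.
- apply: homotopic_sym; rewrite (_ : id = fun y => q (H (s y, 0))); last first.
    by apply/funext => y; rewrite H0 /= sK.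
  rewrite (_ : q \o _ = fun y => q (H (s y, 1))); last first.
    by apply/funext => y; rewrite H1.
  apply: (@compact_quotient_homotopic _ _ _ q s cX hY cq sK _ (q \o H)).
    exact: comp_continuous cH cq.
  move=> x t /=; have /qE[->//|[As Ax]] := sK (q x).
  by apply/qE; right; split; exact: HA.
Qed.

(** * Geometric realizations *)

Definition downclosed (V : finType) (K : {set {set V}}) : Prop :=
  forall s t : {set V}, t \in K -> s \subset t -> s \in K.

Definition supp (R : realType) (V : finType) (x : V -> R) : {set V} :=
  [set v | x v != 0]%SET.

Lemma mem_supp (R : realType) (V : finType) (x : V -> R) v :
  (v \in supp x) = (x v != 0).
Proof. by rewrite inE. Qed.

Lemma supp_scale (R : realType) (V : finType) (x y : V -> R) (c : R) :
  0 < c -> (forall v, y v = c * x v) -> supp y = supp x.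
Proof. by move=> c0 yE; apply/setP => v; rewrite !inE yE mulf_eq0 gt_eqF. Qed.

Definition bary (R : realType) (V : finType) (K : {set {set V}})
  (x : realization R K) (v : V) : R := (set_val x : V -> R) v.

Section Realization.
Context {R : realType} {V : finType} {K : {set {set V}}}.

Lemma bary_ge0 (x : realization R K) v : 0 <= bary x v.
Proof. by have [+ _ _] := set_valP x; apply. Qed.

Lemma bary_sum (x : realization R K) : \sum_v bary x v = 1.
Proof. by have [] := set_valP x. Qed.

Lemma supp_bary (x : realization R K) : supp (bary x) \in K.
Proof. by have [] := set_valP x. Qed.

Lemma bary_inj (x y : realization R K) : bary x =1 bary y -> x = y.
Proof. by move=> xy; apply: val_inj; apply/funext. Qed.

Lemma bary_gt0 (x : realization R K) v : (0 < bary x v) = (v \in supp (bary x)).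
Proof. by rewrite lt0r bary_ge0 andbT mem_supp. Qed.

Lemma bary_le1 (x : realization R K) v : bary x v <= 1.
Proof.
rewrite -(bary_sum x) (bigD1 v)//= lerDl.
by apply: sumr_ge0 => w _; exact: bary_ge0.
Qed.

Lemma exists_bary_gt (x : realization R K) (a : R) :
  a * #|V|%:R < 1 -> exists v, a < bary x v.
Proof.
move=> aV; apply/not_existsP => small; have := aV; apply/negP; rewrite -leNgt.
rewrite -[leLHS](bary_sum x) mulr_natr -sumr_const; apply: ler_sum => v _.
by rewrite leNgt; exact/negP.
Qed.

Lemma exists_bary_gt0 (x : realization R K) : exists v, 0 < bary x v.
Proof. by apply: exists_bary_gt; rewrite mul0r. Qed.

Lemma bary_continuous v : continuous (fun x : realization R K => bary x v).
Proof.
pose ev (z : prod_topology (fun _ : V => R : topologicalType)) := z v.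
apply: (@comp_continuous _ _ _ set_val ev); first exact: initial_continuous.
exact: (@proj_continuous V (fun _ => R : topologicalType) v).
Qed.

Lemma continuous_bary (X : topologicalType) (f : X -> realization R K) :
  (forall v, continuous (fun x => bary (f x) v)) -> continuous f.
Proof.
move=> cf; apply: continuous_comp_initial => x.
apply/cvg_sup => v U [_ [[W oW <-] Wx WU]].
have : nbhs x ((fun x => bary (f x) v) @^-1` W).
  by apply: cf; exact: open_nbhs_nbhs.
by apply: filterS => y Wy; exact: WU.
Qed.

Definition homogeneous_coordinates (X : topologicalType) (F : X -> V -> R) :=
  [/\ forall v, continuous (F^~ v), forall x v, 0 <= F x v,
      forall x, exists v, 0 < F x v & forall x, supp (F x) \in K].

Lemma homogeneous_coordinates_map (X : topologicalType) (F : X -> V -> R) :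
  homogeneous_coordinates F -> exists2 f : X -> realization R K, continuous f
    & forall x, exists2 c, 0 < c & forall v, bary (f x) v = c * F x v.
Proof.
move=> [cF F0 F_pos FK].
have sum_gt0 x : 0 < \sum_v F x v.
  have [v Fv] := F_pos x; rewrite (bigD1 v)//= ltr_pwDl//.
  by apply: sumr_ge0 => u _.
have f_in x : realization_set K (fun v => (\sum_v F x v)^-1 * F x v).
  split => [v||].
  - by rewrite mulr_ge0// invr_ge0 ltW.
  - by rewrite -mulr_sumr mulVf// gt_eqF.
  - rewrite -[[set v | _]%SET]/(supp (fun v => (\sum_v F x v)^-1 * F x v)).
    by rewrite (@supp_scale _ _ (F x) _ (\sum_v F x v)^-1)// invr_gt0.
exists (fun x => SigSub (mem_set (f_in x)) : realization R K).
  apply: continuous_bary => v; apply: mul_fun_continuous => //.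
  apply: inv_fun_continuous => [x|]; first by rewrite gt_eqF.
  by apply: sum_fun_continuous => u _; exact: cF.
by move=> x; exists (\sum_v F x v)^-1 => //; rewrite invr_gt0.
Qed.

Lemma homogeneous_coordinates_supp (X : topologicalType) (F : X -> V -> R) :
  homogeneous_coordinates F -> exists2 f : X -> realization R K, continuous f
    & forall x, supp (bary (f x)) = supp (F x).
Proof.
move=> /homogeneous_coordinates_map[f cf fE]; exists f => // x.
by have [c c0 fxE] := fE x; exact: supp_scale fxE.
Qed.

Hypothesis downK : downclosed K.

Lemma straight_line_homotopy (X : topologicalType) (f g : X -> realization R K)
    (A : set X) (B : set (realization R K)) :
  continuous f -> continuous g ->
  (forall x, supp (bary (f x)) :|: supp (bary (g x)) \in K) ->
  (forall x y, A x ->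
    supp (bary y) \subset supp (bary (f x)) :|: supp (bary (g x)) -> B y) ->
  homotopic_pair R A B f g.
Proof.
move=> cf cg fgK AB; pose F (z : X * R) v :=
  (1 - clamp01 z.2) * bary (f z.1) v + clamp01 z.2 * bary (g z.1) v.
have F_ge0 z v : 0 <= F z v.
  have := clamp01_itv z.2; rewrite in_itv /= => /andP[t0 t1].
  by rewrite addr_ge0// mulr_ge0 ?bary_ge0// subr_ge0.
have F_sum z : \sum_v F z v = 1.
  by rewrite big_split/= -!mulr_sumr !bary_sum !mulr1 subrK.
have F_supp z : supp (F z) \subset supp (bary (f z.1)) :|: supp (bary (g z.1)).
  apply/fintype.subsetP => v; rewrite !inE -negb_and.
  apply: contra => /andP[/eqP fv /eqP gv].
  by rewrite /F fv gv !mulr0 addr0.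
have F_in z : realization_set K (F z).
  by split => //; exact: downK (fgK z.1) (F_supp z).
exists (fun z => SigSub (mem_set (F_in z)) : realization R K); split.
- apply: continuous_bary => v.
  have c_time : continuous (fun z : X * R => clamp01 z.2).
    exact: comp_continuous (@snd_continuous _ _) clamp01_continuous.
  have c_coord (h : X -> realization R K) : continuous h ->
      continuous (fun z : X * R => bary (h z.1) v).
    move=> ch; apply: (@comp_continuous _ _ _ (fun z : X * R => h z.1)
      _ _ (@bary_continuous v)).
    exact: comp_continuous (@fst_continuous _ _) ch.
  have [c_f c_g] := (c_coord _ cf, c_coord _ cg).
  apply: add_fun_continuous; apply: mul_fun_continuous => //.
  by apply: sub_fun_continuous => //; exact: cst_continuous.
- move=> x; apply: bary_inj => v.
  by rewrite {1}/bary set_valE /= /F clamp01_le0//= subr0 mul1r mul0r addr0.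
- move=> x; apply: bary_inj => v.
  by rewrite {1}/bary set_valE /= /F clamp01_ge1//= subrr mul1r mul0r add0r.
- by move=> x t Ax; apply: AB Ax _; exact: F_supp (x, t).
Qed.

Lemma contiguous_homotopic (X : topologicalType) (f g : X -> realization R K) :
  continuous f -> continuous g ->
  (forall x, supp (bary (f x)) :|: supp (bary (g x)) \in K) ->
  homotopic R f g.
Proof. by move=> cf cg fgK; apply/homotopicP/straight_line_homotopy. Qed.

Lemma closed_face (t : {set V}) :
  closed [set x : prod_topology (fun _ : V => R : topologicalType) |
    [/\ forall v, 0 <= x v, \sum_v x v = 1 & forall v, v \notin t -> x v = 0]].
Proof.
pose T : topologicalType := prod_topology (fun _ : V => R : topologicalType).
have coord_continuous v : continuous (fun x : T => x v).
  exact: (@proj_continuous V (fun _ => R : topologicalType) v).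
have closed_pre (h : T -> R) (D : set R) :
    continuous h -> closed D -> closed (h @^-1` D).
  by move=> /continuous_closedP ch cD; exact: ch.
rewrite (_ : [set x | _] = (\bigcap_(v in [set: V]) [set x : T | 0 <= x v]) `&`
    [set x | \sum_v x v = 1] `&`
    \bigcap_(v in [set v | v \notin t]) [set x | x v = 0]).
  apply: closedI; first apply: closedI.
  - by apply: closed_bigI => v _; exact: closed_pre (coord_continuous v) (@closed_ge _ 0).
  - apply: (closed_pre _ [set 1 : R]); last exact: closed_eq.
    by apply: sum_fun_continuous => v _; exact: coord_continuous.
  - by apply: closed_bigI => v _; exact: closed_pre (coord_continuous v) (@closed_eq _ 0).
apply/seteqP; split=> x; last by move=> [[x0 x1] xt]; split=> // v; exact: x0.
by move=> [x0 x1 xt]; split=> //; split=> // v _; exact: x0.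
Qed.

Lemma realization_compact : compact [set: realization R K].
Proof.
apply: set_type_compact.
pose T : topologicalType := prod_topology (fun _ : V => R : topologicalType).
have cube_compact : @compact T [set x : V -> R | forall v, [set` `[0, 1]] (x v)].
  apply: (@tychonoff V (fun _ => R : topologicalType) (fun _ => [set` `[0, 1]])) => v.
  exact: segment_compact.
apply: subclosed_compact cube_compact _; last first.
  move=> x [x0 x1 _] v /=; rewrite in_itv /= x0/= -x1 (bigD1 v)//= lerDl.
  by apply: sumr_ge0 => u _; exact: x0.
rewrite (_ : realization_set K = \bigcup_(t in [set` K]) [set x : T |
    [/\ forall v, 0 <= x v, \sum_v x v = 1 & forall v, v \notin t -> x v = 0]]).
  by apply: closed_bigcup => [|t _]; [exact: finite_finset|exact: closed_face].
apply/seteqP; split => x /=.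
  move=> [x0 x1 xK]; exists [set v | x v != 0]%SET => //; split=> // v.
  by rewrite inE negbK => /eqP.
move=> [t tK [x0 x1 xt]]; split => //; apply: (downK tK).
by apply/fintype.subsetP => v; rewrite inE; apply: contraR => /xt ->.
Qed.

End Realization.
Arguments homogeneous_coordinates {R V} K {X} F.

Lemma contiguous_homotopy_equivalent (R : realType) (V W : finType)
    (K : {set {set V}}) (L : {set {set W}})
    (f : realization R K -> realization R L) (g : realization R L -> realization R K) :
  downclosed K -> downclosed L -> continuous f -> continuous g ->
  (forall x, supp (bary (g (f x))) :|: supp (bary x) \in K) ->
  (forall y, supp (bary (f (g y))) :|: supp (bary y) \in L) ->
  homotopy_equivalent R (realization R K) (realization R L).
Proof.
move=> dK dL cf cg gf fg.
have id_continuous (X : topologicalType) : continuous (@id X).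
  by move=> x; exact: cvg_id.
exists f, g; split => //; apply: contiguous_homotopic => //.
  exact: comp_continuous cf cg.
exact: comp_continuous cg cf.
Qed.

Lemma simplicial_map (R : realType) (V W : finType) (K : {set {set V}})
    (L : {set {set W}}) (phi : V -> W) :
  (forall s : {set V}, s \in K -> phi @: s \in L) ->
  exists2 f : realization R K -> realization R L, continuous f
    & forall x, supp (bary (f x)) = phi @: supp (bary x).
Proof.
move=> phiKL; pose F (x : realization R K) w := \sum_(v | phi v == w) bary x v.
have F_supp x : supp (F x) = phi @: supp (bary x).
  apply/setP => w; rewrite inE psumr_neq0 => [|v _]; last exact: bary_ge0.
  apply/hasP/imsetP => [[v _ /andP[/eqP vw xv]]|[v xv wv]].
    by exists v; rewrite -?bary_gt0.
  by exists v; rewrite ?mem_index_enum// wv eqxx bary_gt0.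
have F_coord : homogeneous_coordinates L F.
  split => [w|x w|x|x].
  - by apply: sum_fun_continuous => v _; exact: bary_continuous.
  - by apply: sumr_ge0 => v _; exact: bary_ge0.
  - have [v xv] := exists_bary_gt0 x; exists (phi v).
    rewrite /F (bigD1 v)//= ltr_pwDl//.
    by apply: sumr_ge0 => u _; exact: bary_ge0.
  - by rewrite F_supp phiKL ?supp_bary.
have [f cf fs] := homogeneous_coordinates_supp F_coord.
by exists f => // x; rewrite fs F_supp.
Qed.

Lemma realization_vertex (R : realType) (V : finType) (K : {set {set V}}) (q : V) :
  [set q]%SET \in K -> exists x : realization R K, supp (bary x) = [set q]%SET.
Proof.
move=> qK; have q_supp : supp (fun v => (v == q)%:R : R) = [set q]%SET.
  by apply/setP => v; rewrite !inE pnatr_eq0 eqb0 negbK.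
have q_in : realization_set K (fun v => (v == q)%:R : R).
  split => [v||]; first exact: ler0n.
    by rewrite (bigD1 q)//= eqxx big1 ?addr0// => v /negbTE ->.
  by rewrite -[[set v | _]%SET]/(supp (fun v => (v == q)%:R : R)) q_supp.
by exists (SigSub (mem_set q_in)).
Qed.

Lemma contractible_realization (R : realType) (V : finType) (K : {set {set V}})
    (phi : V -> V) (q : V) : downclosed K -> (finset.set0 : {set V}) \in K ->
  (forall s : {set V}, s \in K -> s :|: phi @: s \in K) ->
  (forall s : {set V}, s \in K -> q |: phi @: s \in K) ->
  contractible R (realization R K).
Proof.
move=> dK K0 id_phi phi_q.
have [f cf fs] : exists2 f : realization R K -> realization R K, continuous f
    & forall x, supp (bary (f x)) = phi @: supp (bary x).
  apply: simplicial_map => s /id_phi sK; apply: dK sK _; exact: finset.subsetUr.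
have [|xq xqs] := @realization_vertex R _ K q.
  by have := phi_q _ K0; rewrite imset0 finset.setU0.
exists xq; apply: (@homotopic_trans _ _ _ _ f).
  apply: contiguous_homotopic => // [x|x]; first exact: cvg_id.
  by rewrite fs id_phi ?supp_bary.
apply: contiguous_homotopic => // [|x]; first exact: cst_continuous.
by rewrite fs xqs finset.setUC phi_q ?supp_bary.
Qed.

(** * Unions of two cones *)

Section LevelSets.
Context {R : realType} {V : finType}.
Implicit Types (x : V -> R) (s t : {set V}) (P : pred {set V}).

(* If 0 <= x <= 1, the length of the interval of levels c such that s is the
   superlevel set {v | c < x v}. *)
Definition gap x s : R :=
  Num.max 0 (\big[Num.min/1]_(v in s) x v - \big[Num.max/0]_(v in ~: s) x v).

Lemma gap_ge0 x s : 0 <= gap x s.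
Proof. by rewrite /gap le_max lexx. Qed.

Lemma gap_gt0_lt x s v w : 0 < gap x s -> v \in s -> w \notin s -> x w < x v.
Proof.
rewrite /gap lt_max ltxx subr_gt0 /= => s_gap vs ws.
apply: (@le_lt_trans _ _ (\big[Num.max/0]_(u in ~: s) x u)).
  by apply: le_bigmax_cond; rewrite inE.
by apply: lt_le_trans s_gap _; exact: bigmin_le_cond.
Qed.

Lemma gap_gt0_sub_supp x s : 0 < gap x s -> s \subset supp x.
Proof.
rewrite /gap lt_max ltxx subr_gt0 /= => s_gap; apply/fintype.subsetP => v vs.
rewrite mem_supp gt_eqF//.
apply: (@le_lt_trans _ _ (\big[Num.max/0]_(u in ~: s) x u)).
  exact: bigmax_ge_id.
by apply: lt_le_trans s_gap _; exact: bigmin_le_cond.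
Qed.

Lemma gap_supp_gt0 x : (forall v, 0 <= x v) -> 0 < gap x (supp x).
Proof.
move=> x0; rewrite /gap lt_max ltxx subr_gt0 bigmax_eq_id => [|v] /=; last first.
  by rewrite inE mem_supp negbK => /eqP ->.
by apply: lt_bigmin => // v; rewrite mem_supp lt0r x0 andbT.
Qed.

Lemma gap_chain x s t :
  0 < gap x s -> 0 < gap x t -> (s \subset t) || (t \subset s).
Proof.
move=> s_gap t_gap; rewrite -implyNb; apply/implyP => /fintype.subsetPn[v vs vt].
apply/fintype.subsetP => w wt; apply: contraT => ws.
by have := lt_trans (gap_gt0_lt s_gap vs ws) (gap_gt0_lt t_gap wt vt); rewrite ltxx.
Qed.

Lemma gap_continuous (X : topologicalType) (x : X -> V -> R) s :
  (forall v, continuous (x^~ v)) -> continuous (fun z => gap (x z) s).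
Proof.
move=> cx; apply: max_fun_continuous; first exact: cst_continuous.
apply: sub_fun_continuous.
  by apply: bigmin_fun_continuous => [|v _]; [exact: cst_continuous|exact: cx].
by apply: bigmax_fun_continuous => v _; exact: cx.
Qed.

Lemma sum_gap_neq0P x P :
  reflect (exists2 s, P s & 0 < gap x s) (\sum_(s | P s) gap x s != 0).
Proof.
rewrite psumr_neq0 => [|s _]; last exact: gap_ge0.
apply: (iffP hasP) => [[s _ /andP[Ps s_gap]]|[s Ps s_gap]]; exists s => //.
by rewrite Ps.
Qed.

(* The level sets form a chain, so their union is the largest of them. *)
Lemma union_level_sets x (M : {set {set V}}) : (finset.set0 : {set V}) \in M ->
  [set v | \sum_(s in M | v \in s) gap x s != 0]%SET \in M.
Proof.
move=> M0; pose P s := (s \in M) && (0 < gap x s).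
have unionP v : reflect (exists2 s, P s & v \in s)
    (v \in [set v | \sum_(s in M | v \in s) gap x s != 0]%SET).
  rewrite inE; apply: (iffP (sum_gap_neq0P _ _)).
    by move=> [s /andP[sM vs] s_gap]; exists s; rewrite // /P sM.
  by move=> [s /andP[sM s_gap] vs]; exists s; rewrite ?sM.
have [[s0 Ps0]|none] := pselect (exists s, P s); last first.
  rewrite (_ : [set v | _]%SET = finset.set0)//; apply/setP => v; rewrite finset.in_set0.
  by apply/unionP => -[s Ps _]; apply: none; exists s.
case: (@arg_maxnP _ s0 P (fun s => #|s|) Ps0) => s /andP[sM s_gap] s_max.
rewrite (_ : [set v | _]%SET = s)//; apply/setP => v.
apply/unionP/idP => [[t /andP[tM t_gap] vt]|vs]; last by exists s; rewrite // /P sM.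
have [/fintype.subsetP|st] := orP (gap_chain t_gap s_gap); first exact.
have := s_max t; rewrite /P tM t_gap => /(_ isT) ts.
by have /eqP -> : s == t by rewrite eqEcard st.
Qed.

End LevelSets.

Section Suspension.
Context {V : finType}.
Implicit Types (M : {set {set V}}) (s : {set V + bool}).

Definition base_part s : {set V} := [set v | inl v \in s]%SET.

Definition suspension M : {set {set V + bool}} :=
  [set s | (base_part s \in M) && ~~ ((inr true \in s) && (inr false \in s))]%SET.

Lemma mem_base_part s v : (v \in base_part s) = (inl v \in s).
Proof. by rewrite inE. Qed.

Lemma base_partS s s' : s \subset s' -> base_part s \subset base_part s'.
Proof.
move=> /fintype.subsetP ss'; apply/fintype.subsetP => v.
by rewrite !mem_base_part; exact: ss'.
Qed.

Lemma base_part0 : base_part finset.set0 = finset.set0.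
Proof. by apply/setP => v; rewrite !inE. Qed.

Lemma base_partU s s' : base_part (s :|: s') = base_part s :|: base_part s'.
Proof. by apply/setP => v; rewrite !inE. Qed.

Lemma base_part_inr t : base_part [set inr t]%SET = finset.set0.
Proof. by apply/setP => v; rewrite !inE. Qed.

Lemma base_part_inl (e : {set V}) : base_part (@inl V bool @: e) = e.
Proof. by apply/setP => v; rewrite mem_base_part mem_imset// => u w []. Qed.

Lemma inr_imset_inl (e : {set V}) t : (inr t \in @inl V bool @: e) = false.
Proof. by apply/imsetP => -[]. Qed.

Lemma suspensionP M s :
  reflect (base_part s \in M /\ forall t, inr t \in s -> inr (~~ t) \notin s)
          (s \in suspension M).
Proof.
rewrite inE; apply: (iffP andP) => -[sM apex]; split => //.
  by case=> /= st; apply: contra apex => ->; rewrite st.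
by apply/negP => /andP[/apex/negP].
Qed.

Lemma suspension_downclosed M : downclosed M -> downclosed (suspension M).
Proof.
move=> dM s s' /suspensionP[sM apex] ss'; apply/suspensionP; split.
  exact: dM sM (base_partS ss').
move/fintype.subsetP: ss' => ss' t /ss'/apex; apply: contra; exact: ss'.
Qed.

End Suspension.

(* Each [L t] is a cone in the weak sense that the face [F t] can be added to
   any of its faces. *)
Definition cone_pair (V : finType) (L : bool -> {set {set V}})
    (F : bool -> {set V}) : Prop :=
  forall t, [/\ downclosed (L t), (finset.set0 : {set V}) \in L t,
    forall s, s \in L t -> s :|: F t \in L t & F t \notin L (~~ t)].

Section ConePair.
Context {R : realType} {V : finType} (L : bool -> {set {set V}}) (F : bool -> {set V}).
Hypothesis LF : cone_pair L F.
Implicit Types (x : V -> R) (y : V + bool -> R) (s : {set V}).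
Notation K := (L true :|: L false).
Notation M := (L true :&: L false).
Notation X := (realization R K).
Notation Y := (realization R (suspension M)).

Let in_union s : reflect (exists t, s \in L t) (s \in K).
Proof.
apply: (iffP finset.setUP) => [[st|st]|[[] st]]; by [exists true|exists false|left|right].
Qed.

Let in_cap s : reflect (forall t, s \in L t) (s \in M).
Proof.
by apply: (iffP finset.setIP) => [[? ?] []|sL] //; split; exact: sL.
Qed.

Lemma cone_pair_union_downclosed : downclosed K.
Proof.
move=> s s' /in_union[t s't] ss'; apply/in_union; exists t.
by have [dL _ _ _] := LF t; exact: dL s't ss'.
Qed.

Lemma cone_pair_cap_downclosed : downclosed M.
Proof.
move=> s s' /in_cap s'M ss'; apply/in_cap => t.
by have [dL _ _ _] := LF t; exact: dL (s'M t) ss'.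
Qed.

Lemma cone_pair_cap0 : (finset.set0 : {set V}) \in M.
Proof. by apply/in_cap => t; have [] := LF t. Qed.


(* A level set of [x] in [M] pulls [x] to the base, any other one to the apex of
   the only cone that contains it. *)
Let to_susp (x : V -> R) (v : V + bool) : R :=
  match v with
  | inl u => \sum_(s in M | u \in s) gap x s
  | inr t => \sum_(s in L t :\: L (~~ t)) gap x s
  end.

Let from_susp (y : V + bool -> R) (u : V) : R :=
  y (inl u) + \sum_(t | u \in F t) y (inr t).

Let to_susp_ge0 x v : 0 <= to_susp x v.
Proof. by case: v => [u|t]; apply: sumr_ge0 => s _; exact: gap_ge0. Qed.

Let from_susp_ge0 y u : (forall v, 0 <= y v) -> 0 <= from_susp y u.
Proof. by move=> y0; apply: addr_ge0 => //; apply: sumr_ge0. Qed.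

Let to_susp_inl x u : reflect (exists s, [/\ s \in M, u \in s & 0 < gap x s])
  (inl u \in supp (to_susp x)).
Proof.
rewrite mem_supp; apply: (iffP (sum_gap_neq0P _ _)).
  by move=> [s /andP[sM us] s_gap]; exists s.
by move=> [s [sM us s_gap]]; exists s; rewrite ?sM.
Qed.

Let to_susp_inr x t :
  reflect (exists s, [/\ s \in L t, s \notin L (~~ t) & 0 < gap x s])
    (inr t \in supp (to_susp x)).
Proof.
rewrite mem_supp; apply: (iffP (sum_gap_neq0P _ _)).
  by move=> [s]; rewrite inE => /andP[nst st] s_gap; exists s.
by move=> [s [st nst s_gap]]; exists s; rewrite // inE nst.
Qed.

Let to_susp_apex x t : supp x \in K -> inr t \in supp (to_susp x) ->
  supp x \in L t /\ supp x \notin L (~~ t).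
Proof.
move=> /in_union[r xr] /to_susp_inr[s [st nst /gap_gt0_sub_supp sx]].
have nxt : supp x \notin L (~~ t).
  by apply: contra nst => xt; have [dL _ _ _] := LF (~~ t); exact: dL xt sx.
split=> //; suff <- : r = t by [].
by apply/eqP; apply: contraNT nxt; case: r t xr {st nst} => -[].
Qed.

Let to_susp_in x : supp x \in K -> supp (to_susp x) \in suspension M.
Proof.
move=> xK; apply/suspensionP; split.
  rewrite (_ : base_part _ = [set v | \sum_(s in M | v \in s) gap x s != 0]%SET).
    exact: union_level_sets cone_pair_cap0.
  by apply/setP => v; rewrite !inE.
move=> t /(to_susp_apex xK)[xt _]; apply/negP => /(to_susp_apex xK)[_].
by rewrite negbK xt.
Qed.

Let to_susp_pos x : (forall v, 0 <= x v) -> (exists v, 0 < x v) -> supp x \in K ->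
  exists v, 0 < to_susp x v.
Proof.
move=> x0 [w xw] /in_union[t xt]; have x_gap := gap_supp_gt0 x0.
have [v] : exists v, v \in supp (to_susp x).
  have [xt'|xt'] := boolP (supp x \in L (~~ t)).
    exists (inl w); apply/to_susp_inl; exists (supp x); split => //.
      by apply/in_cap; case: t xt xt' => xt xt' [].
    by rewrite mem_supp gt_eqF.
  by exists (inr t); apply/to_susp_inr; exists (supp x).
by exists v; rewrite lt0r -mem_supp to_susp_ge0 andbT.
Qed.

Let mem_from_susp y u : (forall v, 0 <= y v) ->
  reflect (inl u \in supp y \/ exists2 t, u \in F t & inr t \in supp y)
          (u \in supp (from_susp y)).
Proof.
move=> y0; rewrite !mem_supp /from_susp paddr_eq0 ?sumr_ge0// negb_and.
rewrite psumr_neq0//; apply: (iffP orP) => -[yu|]; try by left.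
  by move=> /hasP[t _ /andP[ut yt]]; right; exists t; rewrite // mem_supp gt_eqF.
move=> [t ut yt]; right; apply/hasP; exists t; rewrite ?mem_index_enum// ut.
by rewrite lt0r y0 andbT -mem_supp.
Qed.

Let apex_neq y t r : supp y \in suspension M -> inr t \in supp y ->
  inr r \in supp y -> r = t.
Proof.
move=> /suspensionP[_ apex] /apex nt yr; apply/eqP; apply: contraNT nt => rt.
by rewrite (_ : ~~ t = r)//; case: r t rt {yr} => -[].
Qed.

Let from_susp_sub y t : (forall v, 0 <= y v) -> inr (~~ t) \notin supp y ->
  supp (from_susp y) \subset base_part (supp y) :|:
    (if inr t \in supp y then F t else finset.set0).
Proof.
move=> y0 nt; apply/fintype.subsetP => u.
rewrite finset.in_setU mem_base_part => /(mem_from_susp _ y0)[->//|[r ur yr]].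
have [rt|rt] := eqVneq r t; first by rewrite -rt yr ur orbT.
by case/negP: nt; rewrite (_ : ~~ t = r)//; case: r t rt {ur yr} => -[].
Qed.

Let from_susp_in_cone y t s : (forall v, 0 <= y v) -> supp y \in suspension M ->
  inr (~~ t) \notin supp y -> s \in L t -> base_part (supp y) \subset s ->
  supp (from_susp y) :|: s \in L t.
Proof.
move=> y0 yM nt st ys; have [dL _ LFt _] := LF t.
apply: (dL _ _ (LFt _ st)); rewrite finset.subUset finset.subsetUl andbT.
apply: (fintype.subset_trans (from_susp_sub y0 nt)); apply: finset.setUSS => //.
by case: ifP => // _; exact: finset.sub0set.
Qed.

Let from_susp_in y : (forall v, 0 <= y v) -> supp y \in suspension M ->
  supp (from_susp y) \in K.
Proof.
move=> y0 yM; have /suspensionP[yL apex] := yM.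
have [t nt] : exists t, inr (~~ t) \notin supp y.
  by have [/apex|] := boolP (inr true \in supp y); [exists true|exists false].
apply/in_union; exists t; have [dL _ _ _] := LF t.
apply: (dL _ _ (from_susp_in_cone y0 yM nt (in_cap _ yL t) _) (finset.subsetUl _ _)).
exact: subxx.
Qed.

Let from_susp_pos y : (forall v, 0 <= y v) -> (exists v, 0 < y v) ->
  exists u, 0 < from_susp y u.
Proof.
move=> y0 [[u|t] yv].
  by exists u; rewrite ltr_pwDl// sumr_ge0.
have [u ut] : exists u, u \in F t.
  apply/set0Pn; have [_ _ _] := LF t; apply: contraNneq => ->.
  by have [] := LF (~~ t).
exists u; rewrite lt0r from_susp_ge0// andbT -mem_supp; apply/mem_from_susp => //.
by right; exists t; rewrite // mem_supp gt_eqF.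
Qed.

Let to_from_susp_sub y (w : V -> R) (c : R) : (forall v, 0 <= y v) ->
  supp y \in suspension M -> 0 < c -> (forall u, w u = c * from_susp y u) ->
  supp (to_susp w) \subset supp y.
Proof.
move=> y0 yM c0 wE; have ws := supp_scale c0 wE.
apply/fintype.subsetP => -[u /to_susp_inl[s [sM us s_gap]]|r].
- have /(fintype.subsetP (gap_gt0_sub_supp s_gap)) := us.
  rewrite ws => /(mem_from_susp _ y0)[//|[t ut yt]].
  apply: contraT => yu; have [_ _ _ /negP[]] := LF t.
  have [dL _ _ _] := LF (~~ t); apply: (dL _ _ (in_cap _ sM (~~ t))).
  apply/fintype.subsetP => v vt; apply: contraT => vs.
  have := gap_gt0_lt s_gap us vs; rewrite !wE ltr_pM2l// ltNge => /negP[].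
  have yu0 : y (inl u) = 0 by move: yu; rewrite mem_supp negbK => /eqP.
  rewrite /from_susp yu0 add0r (bigD1 t)//= big1 ?addr0 => [|k /andP[_ kt]].
    apply: ler_wpDl => //; rewrite (bigD1 t)//= lerDl.
    by apply: sumr_ge0.
  by apply/eqP; apply: contraNT kt => yk; apply/eqP/(apex_neq yM yt); rewrite mem_supp.
- move=> /to_susp_inr[s [sr nsr /gap_gt0_sub_supp sw]].
  have /suspensionP[yL _] := yM; rewrite ws in sw.
  apply: contraNT nsr => yr; have [dL _ _ _] := LF (~~ r).
  apply: (dL _ _ (from_susp_in_cone y0 yM _ (in_cap _ yL _) (subxx _))).
    by rewrite negbK.
  exact: fintype.subset_trans sw (finset.subsetUl _ _).
Qed.

Lemma cone_pair_suspension :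
  homotopy_equivalent R (realization R K) (realization R (suspension M)).
Proof.
have [f cf fs] : exists2 f : X -> Y, continuous f
    & forall x : X, supp (bary (f x)) = supp (to_susp (bary x)).
  apply: homogeneous_coordinates_supp; split=> [v|x v|x|x].
  - case: v => [u|t] /=; apply: sum_fun_continuous => s _; apply: gap_continuous;
      exact: bary_continuous.
  - exact: to_susp_ge0.
  - by apply: to_susp_pos (@bary_ge0 _ _ _ x) (exists_bary_gt0 x) (supp_bary x).
  - exact: to_susp_in (supp_bary x).
have [g cg gE] : exists2 g : Y -> X, continuous g & forall y : Y, exists2 c, 0 < c
    & forall u, bary (g y) u = c * from_susp (bary y) u.
  apply: homogeneous_coordinates_map; split=> [u|y u|y|y].
  - apply: add_fun_continuous; first exact: bary_continuous.
    by apply: sum_fun_continuous => t _; exact: bary_continuous.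
  - exact: from_susp_ge0 (bary_ge0 y).
  - exact: from_susp_pos (bary_ge0 y) (exists_bary_gt0 y).
  - exact: from_susp_in (bary_ge0 y) (supp_bary y).
apply: (contiguous_homotopy_equivalent _ _ cf cg).
- exact: cone_pair_union_downclosed.
- exact/suspension_downclosed/cone_pair_cap_downclosed.
- move=> x; have [c c0 /(supp_scale c0) ->] := gE (f x).
  have /in_union[t xt] := supp_bary x; apply/in_union; exists t.
  apply: from_susp_in_cone; rewrite ?fs//; try exact: bary_ge0.
  + exact: to_susp_in (supp_bary x).
  + by apply/negP => /(to_susp_apex (supp_bary x))[_]; rewrite negbK xt.
  + apply/fintype.subsetP => u; rewrite mem_base_part.
    by move=> /to_susp_inl[s [_ us /gap_gt0_sub_supp/fintype.subsetP]]; exact.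
- move=> y; have [c c0 gyE] := gE y; rewrite fs.
  rewrite (finset.setUidPr _) ?supp_bary//.
  exact: to_from_susp_sub (bary_ge0 y) (supp_bary y) c0 gyE.
Qed.

Lemma cone_pair_contractible (phi : V -> V) (q : V) :
  (forall s : {set V}, s \in M -> s :|: phi @: s \in M) ->
  (forall s : {set V}, s \in M -> q |: phi @: s \in M) ->
  contractible R (realization R K).
Proof.
move=> id_phi phi_q; apply: homotopy_equivalent_contractible cone_pair_suspension _.
pose psi (v : V + bool) := if v is inl u then inl (phi u) else v.
have psi_base (t : {set V + bool}) : base_part (psi @: t) = phi @: base_part t.
  apply/setP => u; rewrite mem_base_part; apply/imsetP/imsetP => [[[v|//] vs [->]]|].
    by exists v; rewrite ?mem_base_part.
  by move=> [v vs ->]; exists (inl v); rewrite -?mem_base_part.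
have psi_apex (s : {set V + bool}) t : (inr t \in psi @: s) = (inr t \in s).
  by apply/imsetP/idP => [[[//|r] rs [->]]|ts]; last exists (inr t).
have M0 := cone_pair_cap0; have dM := cone_pair_cap_downclosed.
apply: (@contractible_realization _ _ _ psi (inl q)).
- exact: suspension_downclosed.
- apply/suspensionP; split=> [|t]; last by rewrite finset.in_set0.
  by rewrite base_part0.
- move=> s /suspensionP[sM apex]; apply/suspensionP; split=> [|t].
    by rewrite base_partU psi_base id_phi.
  by rewrite !finset.in_setU !psi_apex !orbb; exact: apex.
- move=> s /suspensionP[sM apex]; apply/suspensionP; split=> [|t].
    by rewrite base_partU psi_base -imset_set1 base_part_inl phi_q.
  by rewrite !finset.in_setU1 !psi_apex; exact: apex.
Qed.

End ConePair.

(** * The open simplex and the sphere *)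

Section Stereographic.
Context {R : realType} {d : nat}.
Implicit Types (a b v w : 'I_d.+1 -> R) (y : 'rV[R]_d.+1).

Definition simplex_min a : R := \big[Num.min/a ord0]_k a k.

Definition simplex_dist a : R :=
  \sum_k (a ord0 - a k) ^+ 2 + (1 - \sum_k a k) ^+ 2.

(* On the open simplex, where the last term of [simplex_dist] vanishes, this is
   the inverse stereographic projection of the vector with coordinates
   (a_0 - a_k) / min a; homogenizing it by min a extends it continuously to the
   boundary, which goes to the pole. *)
Definition simplex_sphere a : 'rV[R]_d.+1 :=
  let h := simplex_min a in let D := simplex_dist a in
  \row_k ((if k == ord0 then D - h ^+ 2 else 2 * h * (a ord0 - a k)) / (D + h ^+ 2)).

Lemma simplex_min_le a k : simplex_min a <= a k.
Proof. exact: bigmin_le. Qed.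

Lemma simplex_min_attained a : exists k, simplex_min a = a k.
Proof.
rewrite /simplex_min; elim/big_ind: _ => [|r s [k ->] [l ->]|k _].
- by exists ord0.
- by case: (leP (a k) (a l)) => _; [exists k|exists l].
- by exists k.
Qed.

Lemma simplex_den_gt0 a : 0 < simplex_dist a + simplex_min a ^+ 2.
Proof.
have sq0 : 0 <= \sum_k (a ord0 - a k) ^+ 2 by apply: sumr_ge0 => k _; exact: sqr_ge0.
rewrite /simplex_dist lt0r !addr_ge0 ?sqr_ge0// andbT.
rewrite !paddr_eq0 ?addr_ge0 ?sqr_ge0// !sqrf_eq0.
apply/negP => /andP[/andP[/eqP a_const sum1] /eqP min0].
have {}a_const k : a k = a ord0.
  apply/esym/eqP; rewrite -subr_eq0 -sqrf_eq0; apply/eqP.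
  by apply: (psumr_eq0P _ a_const) => // l _; exact: sqr_ge0.
have [k kmin] := simplex_min_attained a.
move: sum1; rewrite big1 => [|l _]; first by rewrite subr0 oner_eq0.
by rewrite a_const -(a_const k) -kmin.
Qed.

Lemma simplex_dist_sum1 a : \sum_k a k = 1 ->
  simplex_dist a = \sum_k (a ord0 - a k) ^+ 2.
Proof. by move=> a1; rewrite /simplex_dist a1 subrr expr0n addr0. Qed.

Lemma simplex_sphere_sphere a :
  simplex_min a = 0 \/ \sum_k a k = 1 -> sphere (simplex_sphere a).
Proof.
move=> a_cell; have D0 := lt0r_neq0 (simplex_den_gt0 a); rewrite /sphere /=.
pose h := simplex_min a; pose D := simplex_dist a.
have hD : h ^+ 2 * \sum_k (a ord0 - a k) ^+ 2 = h ^+ 2 * D.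
  case: a_cell => [h0|/simplex_dist_sum1 <-//].
  by rewrite /h h0 expr0n !mul0r.
rewrite (eq_bigr (fun k => (D + h ^+ 2) ^- 2 *
    (if k == ord0 then (D - h ^+ 2) ^+ 2 else 4 * h ^+ 2 * (a ord0 - a k) ^+ 2))).
  rewrite -mulr_sumr big_ord_recl eqxx.
  rewrite (eq_bigr (fun k => 4 * h ^+ 2 * (a ord0 - a (lift ord0 k)) ^+ 2))//.
  rewrite -mulr_sumr -mulrA.
  have -> : \sum_(i < d) (a ord0 - a (lift ord0 i)) ^+ 2 =
      \sum_k (a ord0 - a k) ^+ 2.
    by rewrite big_ord_recl subrr expr0n add0r.
  by rewrite hD; field.
by move=> k _; rewrite !mxE -/h -/D; case: ifP => _; field.
Qed.

Lemma simplex_sphere_base a :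
  simplex_sphere a = delta_mx ord0 ord0 <-> simplex_min a = 0.
Proof.
have D0 := lt0r_neq0 (simplex_den_gt0 a); split=> [/rowP/(_ ord0)|h0].
  rewrite !mxE eqxx /= => /(canRL (mulfVK D0)); rewrite mul1r => e.
  by apply/eqP; rewrite -sqrf_eq0; apply/eqP; lra.
rewrite h0 expr0n addr0 in D0; apply/rowP => k.
rewrite !mxE h0 expr0n /= subr0 addr0 mulr0 mul0r.
by case: eqP => _; rewrite ?divff ?mul0r.
Qed.

Lemma eq_shifted_min a b (c : R) : simplex_min a = simplex_min b ->
  (forall k, a k = b k + c) -> c = 0.
Proof.
move=> ab abc; have [k ak] := simplex_min_attained a.
have [l bl] := simplex_min_attained b.
have := simplex_min_le b k; have := simplex_min_le a l.
by have := abc k; have := abc l; lra.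
Qed.

Lemma simplex_minZ a (c : R) : 0 < c ->
  simplex_min (fun k => c * a k) = c * simplex_min a.
Proof.
move=> c0; have [k ak] := simplex_min_attained a.
apply/le_anti/andP; split; first by rewrite ak; exact: simplex_min_le.
have [l ->] := simplex_min_attained (fun k => c * a k).
by rewrite ler_pM2l// simplex_min_le.
Qed.

Definition slope a k : R := (a ord0 - a k) / simplex_min a.

Lemma slope0 a : slope a ord0 = 0.
Proof. by rewrite /slope subrr mul0r. Qed.

Lemma slope_inj a b : 0 < simplex_min a -> 0 < simplex_min b ->
  \sum_k a k = 1 -> \sum_k b k = 1 -> slope a =1 slope b -> a =1 b.
Proof.
move=> ha hb a1 b1 ab; pose h := simplex_min a; pose g := simplex_min b.
have scaled k : h^-1 * a k = g^-1 * b k.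
  have slope_ab l : h^-1 * (a ord0 - a l) = g^-1 * (b ord0 - b l).
    by rewrite ![_^-1 * _]mulrC; exact: ab.
  have : h^-1 * a ord0 - g^-1 * b ord0 = 0.
    apply: (@eq_shifted_min (fun k => h^-1 * a k) (fun k => g^-1 * b k)) => [|l].
      by rewrite !simplex_minZ ?invr_gt0// !mulVf// gt_eqF.
    by have := slope_ab l; rewrite !mulrBr; lra.
  by have := slope_ab k; rewrite !mulrBr; lra.
have : h^-1 * \sum_k a k = g^-1 * \sum_k b k.
  by rewrite !mulr_sumr; apply: eq_bigr => k _; exact: scaled.
rewrite a1 b1 !mulr1 => /invr_inj hg k.
have g0 : g^-1 != 0 by rewrite invr_eq0 gt_eqF.
by apply: (mulfI g0); rewrite -scaled hg.
Qed.

Lemma slope_surj w : w ord0 = 0 ->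
  exists a, [/\ 0 < simplex_min a, \sum_k a k = 1 & slope a =1 w].
Proof.
move=> w0; pose M := \big[Num.max/0]_k w k; pose b k := 1 + M - w k.
have b_ge1 k : 1 <= b k by rewrite /b -addrA lerDl subr_ge0 le_bigmax.
have min_b : simplex_min b = 1.
  apply/le_anti/andP; split; last first.
    by have [k ->] := simplex_min_attained b; exact: b_ge1.
  have [k Mk] : exists k, M = w k.
    rewrite /M; elim/big_ind: _ => [|r s [k ->] [l ->]|k _]; last by exists k.
      by exists ord0.
    by case: (leP (w k) (w l)) => _; [exists l|exists k].
  by apply: le_trans (simplex_min_le b k) _; rewrite /b Mk addrK.
pose S := \sum_k b k; have S0 : 0 < S.
  rewrite /S big_ord_recl ltr_pwDl ?sumr_ge0// => [|k _].
    exact: lt_le_trans (b_ge1 _).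
  exact: le_trans (b_ge1 _).
exists (fun k => S^-1 * b k); rewrite /slope simplex_minZ ?invr_gt0// min_b mulr1.
split=> [||k]; first by rewrite invr_gt0.
  by rewrite -mulr_sumr mulVf// gt_eqF.
by rewrite -mulrBr invrK mulrAC mulVf ?gt_eqF// /b w0; ring.
Qed.

(* The point of the first axis is the pole, and [w ord0] is meant to be 0. *)
Definition inverse_stereographic w : 'rV[R]_d.+1 :=
  let N := \sum_k w k ^+ 2 in
  \row_k ((if k == ord0 then N - 1 else 2 * w k) / (N + 1)).

Lemma simplex_sphere_slope a : 0 < simplex_min a -> \sum_k a k = 1 ->
  simplex_sphere a = inverse_stereographic (slope a).
Proof.
move=> h0 a1; have D0 := lt0r_neq0 (simplex_den_gt0 a).
have sum_slope : \sum_k (a ord0 - a k) ^+ 2 =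
    simplex_min a ^+ 2 * \sum_k slope a k ^+ 2.
  rewrite mulr_sumr; apply: eq_bigr => k _.
  by rewrite -exprMn /slope mulrCA mulfV ?mulr1// gt_eqF.
rewrite /simplex_sphere simplex_dist_sum1// sum_slope in D0 *.
have N0 : \sum_k slope a k ^+ 2 + 1 != 0.
  by rewrite gt_eqF// ltr_wpDl// sumr_ge0// => k _; exact: sqr_ge0.
apply/rowP => k; rewrite !mxE.
have -> : a ord0 - a k = simplex_min a * slope a k.
  by rewrite /slope mulrCA mulfV ?mulr1// gt_eqF.
by case: eqP => _; field; rewrite N0 D0.
Qed.

Lemma inverse_stereographic_inj v w : v ord0 = 0 -> w ord0 = 0 ->
  inverse_stereographic v = inverse_stereographic w -> v =1 w.
Proof.
move=> v0 w0 /rowP vw.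
have den_neq0 (u : 'I_d.+1 -> R) : \sum_k u k ^+ 2 + 1 != 0.
  by rewrite gt_eqF// ltr_wpDl// sumr_ge0// => k _; exact: sqr_ge0.
have N_eq : \sum_k v k ^+ 2 + 1 = \sum_k w k ^+ 2 + 1.
  have poleE (N : R) : N + 1 != 0 -> (N - 1) / (N + 1) = 1 - 2 * (N + 1)^-1.
    by move=> ?; field.
  by have := vw ord0; rewrite !mxE !poleE// => vw0; apply: invr_inj; lra.
move=> k; have [->|k0] := eqVneq k ord0; first by rewrite v0 w0.
have := vw k; rewrite !mxE (negbTE k0) N_eq => /(mulIf (invr_neq0 (den_neq0 w))).
by move=> /mulfI; apply; rewrite pnatr_eq0.
Qed.

Lemma inverse_stereographic_surj y : sphere y -> y != delta_mx ord0 ord0 ->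
  exists2 w, w ord0 = 0 & inverse_stereographic w = y.
Proof.
rewrite /sphere /= big_ord_recl => y_sphere y_base; set y0 := y ord0 ord0.
have y1 : 1 - y0 != 0.
  apply: contra_neq y_base => /eqP; rewrite subr_eq0 eq_sym => /eqP y0E.
  move: y_sphere; rewrite -/y0 y0E expr1n -[RHS]addr0 => /addrI sum0.
  apply/rowP => k; rewrite mxE eqxx /=; case: (unliftP ord0 k) => [l ->|->//].
  apply/eqP; rewrite -sqrf_eq0; apply/eqP.
  by apply: (psumr_eq0P _ sum0) => // i _; exact: sqr_ge0.
exists (fun k => if k == ord0 then 0 else y ord0 k / (1 - y0)) => //.
have N_eq : \sum_k (if k == ord0 then 0 else y ord0 k / (1 - y0)) ^+ 2 =
    (1 + y0) / (1 - y0).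
  rewrite big_ord_recl expr0n add0r.
  rewrite (eq_bigr (fun k => (1 - y0) ^- 2 * y ord0 (lift ord0 k) ^+ 2)).
    rewrite -mulr_sumr; move: y_sphere; rewrite -/y0.
    by move=> /(canRL (addKr _)) ->; field.
  by move=> k _ /=; rewrite expr_div_n mulrC.
have two : 1 + y0 + (1 - y0) != 0 by rewrite gt_eqF//; lra.
apply/rowP => k; rewrite mxE N_eq; case: eqVneq => [->|k0].
  by rewrite -/y0; field; rewrite y1 two.
by field; rewrite y1 two.
Qed.

Lemma simplex_sphere_inj a b : 0 < simplex_min a -> 0 < simplex_min b ->
  \sum_k a k = 1 -> \sum_k b k = 1 -> simplex_sphere a = simplex_sphere b -> a =1 b.
Proof.
move=> ha hb a1 b1; rewrite !simplex_sphere_slope// => ab.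
by apply: slope_inj => //; apply: inverse_stereographic_inj ab; exact: slope0.
Qed.

Lemma simplex_sphere_surj y : sphere y -> y != delta_mx ord0 ord0 ->
  exists a, [/\ 0 < simplex_min a, \sum_k a k = 1 & simplex_sphere a = y].
Proof.
move=> y_sphere y_base.
have [w w0 wy] := inverse_stereographic_surj y_sphere y_base.
have [a [ha a1 /funext aw]] := slope_surj w0.
by exists a; split; rewrite // simplex_sphere_slope// aw.
Qed.

Lemma continuous_mx (X : topologicalType) (p q : nat) (f : X -> 'M[R]_(p, q)) :
  (forall i j, continuous (fun x => f x i j)) -> continuous f.
Proof.
move=> cf x A [P PM PA].
have : \forall y \near x, forall i, forall j, P i j (f y i j).
  apply: filter_forall => i; apply: filter_forall => j; apply: cf; exact: PM.
by apply: filterS => y Py; exact: PA.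
Qed.

Lemma simplex_min_continuous (X : topologicalType) (a : X -> 'I_d.+1 -> R) :
  (forall k, continuous (a^~ k)) -> continuous (fun x => simplex_min (a x)).
Proof. by move=> ca; apply: bigmin_fun_continuous => [|k _]; exact: ca. Qed.

Lemma simplex_sphere_continuous (X : topologicalType) (a : X -> 'I_d.+1 -> R) :
  (forall k, continuous (a^~ k)) -> continuous (fun x => simplex_sphere (a x)).
Proof.
move=> ca; have sqr_continuous (f : X -> R) :
    continuous f -> continuous (fun x => f x ^+ 2).
  by move=> cf; under eq_fun do rewrite expr2; exact: mul_fun_continuous.
have min_cont := simplex_min_continuous ca.
have dist_cont : continuous (fun x => simplex_dist (a x)).
  apply: add_fun_continuous.
    by apply: sum_fun_continuous => k _; apply: sqr_continuous; exact: sub_fun_continuous.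
  apply: sqr_continuous; apply: sub_fun_continuous; first exact: cst_continuous.
  by apply: sum_fun_continuous => k _; exact: ca.
apply: continuous_mx => i k; under eq_fun do rewrite mxE.
apply: mul_fun_continuous; last first.
  apply: inv_fun_continuous => [x|]; first by rewrite gt_eqF ?simplex_den_gt0.
  by apply: add_fun_continuous => //; exact: sqr_continuous.
case: (k == ord0); first by apply: sub_fun_continuous => //; exact: sqr_continuous.
apply: mul_fun_continuous; last exact: sub_fun_continuous.
by apply: mul_fun_continuous => //; exact: cst_continuous.
Qed.

End Stereographic.

(** * Deleting facets *)

Definition facet_family (V : finType) (K T : {set {set V}}) (d : nat) : Prop :=
  forall t, t \in T ->
    [/\ t \in K, #|t| = d & forall s : {set V}, s \in K -> t \subset s -> s = t].

Lemma facet_deletion_downclosed (V : finType) (K T : {set {set V}}) (d : nat) :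
  downclosed K -> facet_family K T d -> downclosed (K :\: T).
Proof.
move=> downK facetT s s'; rewrite !inE => /andP[s'T s'K] ss'.
rewrite (downK _ _ s'K ss') andbT; apply: contra s'T => sT.
by have [_ _ /(_ _ s'K ss') ->] := facetT _ sT.
Qed.

Section FacetDeletion.
Context {R : realType} {V : finType} {K T : {set {set V}}} {d : nat}.
Hypotheses (downK : downclosed K) (facetT : facet_family K T d.+1).
Notation X := (realization R K).
Notation A := (realization R (K :\: T)).
Implicit Types (x : X) (s t : {set V}).

Definition facet_min (x : V -> R) t : R := \big[Num.min/1]_(v in t) x v.

Definition depth (x : V -> R) : R := \sum_(t in T) facet_min x t.

Lemma facet_min_ge0 x t : 0 <= facet_min (bary x) t.
Proof. by apply: le_bigmin => // v _; exact: bary_ge0. Qed.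

Lemma facet_min_gt0 x t : (0 < facet_min (bary x) t) = (t \subset supp (bary x)).
Proof.
apply/bigmin_gtP/fintype.subsetP => [[_ tx] v /tx|tx]; first by rewrite bary_gt0.
by split=> // v /tx; rewrite bary_gt0.
Qed.

Lemma facet_min_eq0 x t : t \in T -> t != supp (bary x) -> facet_min (bary x) t = 0.
Proof.
move=> tT; apply: contraNeq => x_t.
have [_ _ t_max] := facetT tT; apply/eqP/esym/t_max; first exact: supp_bary.
by rewrite -facet_min_gt0 lt0r x_t facet_min_ge0.
Qed.

Lemma depth_eq0 x : supp (bary x) \notin T -> depth (bary x) = 0.
Proof.
move=> xT; apply: big1 => t tT; apply: facet_min_eq0 => //.
by apply: contraNneq xT => <-.
Qed.

Lemma depth_facet x : supp (bary x) \in T ->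
  depth (bary x) = facet_min (bary x) (supp (bary x)).
Proof.
move=> xT; rewrite /depth (bigD1 _ xT)/= big1 ?addr0// => t /andP[tT tx].
exact: facet_min_eq0.
Qed.

Lemma depth_ge0 x : 0 <= depth (bary x).
Proof. by apply: sumr_ge0 => t _; exact: facet_min_ge0. Qed.

Lemma depth_attained x : supp (bary x) \in T ->
  exists2 v, v \in supp (bary x) & bary x v = depth (bary x).
Proof.
move=> xT; have [_ cardx _] := facetT xT.
have [v vx] : exists v, v \in supp (bary x) by apply/set0Pn; rewrite -card_gt0 cardx.
have [u ux u_min] := @eq_bigmin _ _ _ 1 v [in supp (bary x)] (bary x) vx
  (fun u _ => bary_le1 x u).
by exists u => //; rewrite depth_facet.
Qed.

Lemma depth_continuous : continuous (fun x => depth (bary x)).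
Proof.
apply: sum_fun_continuous => t _; apply: bigmin_fun_continuous => [|v _].
  exact: cst_continuous.
exact: bary_continuous.
Qed.

Let radius : R := (#|V|.+1%:R)^-1.

(* Pushes a point of a deleted facet away from its barycentre; a point at depth
   at most [radius] reaches the boundary. *)
Let shrink (x : V -> R) v : R := Num.max 0 (x v - Num.min (depth x) radius).

Let radius_gt0 : 0 < radius.
Proof. by rewrite invr_gt0 ltr0Sn. Qed.

Let shrink_ge0 (x : V -> R) v : 0 <= shrink x v.
Proof. by rewrite /shrink le_max lexx. Qed.

Let shrink_sub x : supp (shrink (bary x)) \subset supp (bary x).
Proof.
apply/fintype.subsetP => v; rewrite !mem_supp; apply: contra => /eqP xv.
rewrite /shrink xv sub0r max_l// oppr_le0 le_min depth_ge0.
exact: ltW.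
Qed.

Let shrink_pos x : exists v, 0 < shrink (bary x) v.
Proof.
have [|v xv] := @exists_bary_gt _ _ _ x radius.
  by rewrite /radius mulrC ltr_pdivrMr ?ltr0Sn// mul1r ltr_nat.
by exists v; rewrite /shrink lt_max subr_gt0 gt_min xv !orbT.
Qed.

Let shrink_in x : supp (shrink (bary x)) \in K.
Proof. exact: downK (supp_bary x) (shrink_sub x). Qed.

Let shrink_boundary x : depth (bary x) <= radius ->
  supp (shrink (bary x)) \in K :\: T.
Proof.
move=> x_radius; rewrite inE shrink_in andbT; apply/negP => xT.
have [_ _ t_max] := facetT xT; have xE := t_max _ (supp_bary x) (shrink_sub x).
have [|v vx v_min] := @depth_attained x; first by rewrite xE.
move: vx; rewrite xE mem_supp /shrink v_min min_l// subrr max_l// eqxx.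
by [].
Qed.

Let shrink_continuous v : continuous (fun x => shrink (bary x) v).
Proof.
apply: max_fun_continuous; first exact: cst_continuous.
apply: sub_fun_continuous; first exact: bary_continuous.
by apply: min_fun_continuous; [exact: depth_continuous|exact: cst_continuous].
Qed.

Let incl_in (a : A) : realization_set K (bary a).
Proof.
split; [exact: bary_ge0|exact: bary_sum|].
by have := supp_bary a; rewrite inE => /andP[].
Qed.

Let incl (a : A) : X := SigSub (mem_set (incl_in a)).

Let incl_continuous : continuous incl.
Proof. by apply: continuous_bary => v; exact: bary_continuous. Qed.

Let corestrict (Z : topologicalType) (f : Z -> X) : continuous f ->
  (forall z, supp (bary (f z)) \notin T) ->
  exists2 g : Z -> A, continuous g & forall z, incl (g z) = f z.
Proof.
move=> cf fT; have f_in z : realization_set (K :\: T) (bary (f z)).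
  by split; [exact: bary_ge0|exact: bary_sum|rewrite !inE fT supp_bary].
exists (fun z => SigSub (mem_set (f_in z))); last by move=> z; exact: bary_inj.
by apply: continuous_bary => v; exact: comp_continuous cf (@bary_continuous _ _ _ v).
Qed.

Let incl_notin (a : A) : supp (bary (incl a)) \notin T.
Proof. by have := supp_bary a; rewrite inE => /andP[]. Qed.

Lemma facet_deletion_point : A -> exists x, supp (bary x) \notin T.
Proof. by move=> a; exists (incl a); exact: incl_notin. Qed.

Notation deleted := [set x : X | supp (bary x) \notin T].

Let extended_contraction (rho : X -> X) : contractible R A -> continuous rho ->
  (forall x, depth (bary x) <= radius -> supp (bary (rho x)) \notin T) ->
  exists2 e : X -> X, homotopic_pair R deleted deleted rho e
    & exists x0, forall x, deleted x -> e x = x0.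
Proof.
move=> [a0 /homotopicP[C [cC C0 C1 _]]] crho rhoT.
have [near cnear nearE] : exists2 near : [set x | depth (bary x) <= radius] -> A,
    continuous near & forall z, incl (near z) = rho (set_val z).
  apply: corestrict => [|x]; last exact: rhoT (set_valP x).
  by apply: comp_continuous crho; exact: initial_continuous.
have [|z|G [cG G0 GE]] := damped_homotopy_extension radius_gt0 depth_continuous
  cnear _ crho (C := incl \o C).
- exact: comp_continuous cC incl_continuous.
- by rewrite /= C0 nearE.
have deleted_near x : deleted x -> [set x | depth (bary x) <= radius] x.
  by move=> /depth_eq0 /= ->; exact: ltW.
exists (fun x => G (x, 1)).
  exists G; split => // x r xT.
  by rewrite (GE _ (deleted_near x xT)); exact: incl_notin.
exists (incl a0) => x xT; rewrite (GE _ (deleted_near x xT)) depth_eq0//.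
by rewrite mul0r subr0 mulr1 /= C1.
Qed.

Lemma facet_deletion_deformation : contractible R A ->
  exists2 e : X -> X, homotopic_pair R deleted deleted id e
    & exists x0, forall x, deleted x -> e x = x0.
Proof.
move=> A_contractible.
have [rho crho rhos] : exists2 rho : X -> X, continuous rho &
    forall x, supp (bary (rho x)) = supp (shrink (bary x)).
  apply: homogeneous_coordinates_supp.
  by split; [exact: shrink_continuous|move=> x v; exact: shrink_ge0
    |exact: shrink_pos|exact: shrink_in].
have rhoT x : depth (bary x) <= radius -> supp (bary (rho x)) \notin T.
  by move=> /shrink_boundary; rewrite inE rhos => /andP[].
have [e rho_e e_const] := extended_contraction A_contractible crho rhoT.
exists e => //; apply: homotopic_pair_trans rho_e; apply: straight_line_homotopy.
- exact: downK.
- by move=> x; exact: cvg_id.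
- exact: crho.
- by move=> x; rewrite rhos (finset.setUidPl (shrink_sub x)) supp_bary.
- move=> x y xT; rewrite rhos (finset.setUidPl (shrink_sub x)) => yx /=.
  have := supp_bary x; move: xT => /= xT xK.
  have : supp (bary x) \in K :\: T by rewrite inE xT.
  by move=> /(facet_deletion_downclosed downK facetT)/(_ yx); rewrite inE => /andP[].
Qed.

End FacetDeletion.

Section FacetDeletionWedge.
Context {R : realType} {V : finType} {K T : {set {set V}}} {d : nat}.
Hypotheses (downK : downclosed K) (facetT : facet_family K T d.+1).
Notation X := (realization R K).
Notation pt := (sphere_point R d).
Notation sphere_d := (set_type (@sphere R d)).
Notation W := (wedge_of_spheres R d #|T|).
Implicit Types (x : X) (j : 'I_#|T|).

Let facet j : {set V} := enum_val j.

Let facetP j : facet j \in T. Proof. exact: enum_valP. Qed.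

Let card_facet j : #|facet j| = d.+1.
Proof. by have [] := facetT (facetP j). Qed.

Let corner j (k : 'I_d.+1) : V := enum_val (cast_ord (esym (card_facet j)) k).

Let corner_in j k : corner j k \in facet j. Proof. exact: enum_valP. Qed.

Let corner_inj j : injective (corner j).
Proof. by move=> k l /enum_val_inj/cast_ord_inj. Qed.

Let corner_imset j : corner j @: 'I_d.+1 = facet j.
Proof.
apply/eqP; rewrite eqEcard (card_imset _ (@corner_inj j)) card_ord card_facet leqnn.
by rewrite andbT; apply/fintype.subsetP => _ /imsetP[k _ ->]; exact: corner_in.
Qed.

Let sum_corner j (F : V -> R) : \sum_k F (corner j k) = \sum_(v in facet j) F v.
Proof.
by rewrite -corner_imset big_imset//= => k l _ _; exact: corner_inj.
Qed.

Let coord j x (k : 'I_d.+1) : R := bary x (corner j k).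

Let coord_min_ge0 j x : 0 <= simplex_min (coord j x).
Proof. by have [k ->] := simplex_min_attained (coord j x); exact: bary_ge0. Qed.

Let coord_min_gt0 j x : (0 < simplex_min (coord j x)) = (supp (bary x) == facet j).
Proof.
apply/idP/eqP => [x_pos|xj]; last first.
  have [k ->] := simplex_min_attained (coord j x).
  by rewrite bary_gt0 xj corner_in.
have [_ _ facet_max] := facetT (facetP j); apply: facet_max; first exact: supp_bary.
rewrite -corner_imset; apply/fintype.subsetP => _ /imsetP[k _ ->].
by rewrite -bary_gt0; apply: lt_le_trans x_pos _; exact: simplex_min_le.
Qed.

Let coord_min_eq0 j x : (simplex_min (coord j x) == 0) = (supp (bary x) != facet j).
Proof. by rewrite -coord_min_gt0 lt0r coord_min_ge0 andbT negbK. Qed.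

Let coord_sum j x : supp (bary x) = facet j -> \sum_k coord j x k = 1.
Proof.
move=> xj; rewrite sum_corner -(bary_sum x) [RHS](bigID [in facet j])/=.
rewrite [Y in _ = _ + Y]big1 ?addr0// => v; rewrite -xj mem_supp negbK.
by move=> /eqP.
Qed.

Let facet_sphere_in j x : sphere (simplex_sphere (coord j x)).
Proof.
apply: simplex_sphere_sphere; have [xj|xj] := eqVneq (supp (bary x)) (facet j).
  by right; exact: coord_sum.
by left; apply/eqP; rewrite coord_min_eq0.
Qed.

Let facet_sphere j x : sphere_d := SigSub (mem_set (facet_sphere_in j x)).

Let facet_sphere_pt j x : facet_sphere j x = pt <-> supp (bary x) <> facet j.
Proof.
split=> [/(congr1 set_val)/simplex_sphere_base/eqP|xj].
  by rewrite coord_min_eq0 => /eqP.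
by apply/val_inj/simplex_sphere_base/eqP; rewrite coord_min_eq0; exact/eqP.
Qed.

Let facet_sphere_continuous j : continuous (facet_sphere j).
Proof.
apply: continuous_comp_initial.
apply: (@simplex_sphere_continuous _ _ _ (coord j)) => k; exact: bary_continuous.
Qed.

Let lift j : sphere_d -> W :=
  @wedge_lift _ (fun _ : 'I_#|T| => sphere_d) (fun=> pt) j.

Let lift_pt i j : lift i pt = lift j pt.
Proof. exact: (@wedge_liftE _ (fun _ : 'I_#|T| => sphere_d) (fun=> pt) j pt i pt). Qed.

Let proj j : W -> sphere_d :=
  @wedge_fun _ (fun _ : 'I_#|T| => sphere_d) (fun=> pt) _
    (fun i y => if i == j then y else pt).

Let proj_lift j i y : proj j (lift i y) = if i == j then y else pt.
Proof. by rewrite /proj wedge_lift_funE// => i' j'; do 2 case: ifP. Qed.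

Hypothesis T_gt0 : (0 < #|T|)%N.
Let j0 : 'I_#|T| := Ordinal T_gt0.

Let only_facet x : exists j, forall i, i != j -> supp (bary x) <> facet i.
Proof.
have [[j xj]|none] := pselect (exists j, supp (bary x) = facet j).
  by exists j => i /eqP ij; rewrite xj => /enum_val_inj/esym.
by exists j0 => i _ xi; apply: none; exists i.
Qed.

Let facet_of x : 'I_#|T| := xget j0 [set j | supp (bary x) = facet j].

Let q x : W := lift (facet_of x) (facet_sphere (facet_of x) x).

Let qE j x : (forall i, i != j -> supp (bary x) <> facet i) ->
  q x = lift j (facet_sphere j x).
Proof.
move=> x_only; rewrite /q; have [->//|ij] := eqVneq (facet_of x) j.
rewrite (facet_sphere_pt _ x).2; last exact: x_only.
rewrite (lift_pt _ j) (facet_sphere_pt j x).2// => xj.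
move: ij; rewrite /facet_of (xget_unique j0 xj) ?eqxx// => k.
by rewrite xj => /enum_val_inj.
Qed.

Let proj_q j x : proj j (q x) = facet_sphere j x.
Proof.
have [i x_only] := only_facet x; rewrite (qE x_only) proj_lift.
by case: eqVneq => [->//|ij]; apply/esym/facet_sphere_pt/x_only; rewrite eq_sym.
Qed.

Let q_continuous : continuous q.
Proof.
pose only j : set X :=
  \bigcap_(i in [set i | i != j]) [set x | simplex_min (coord i x) = 0].
apply: (@closed_cover_continuous _ _ _ only) => [j|x|j].
- apply: closed_bigI => i _; apply: (preimage_closed _ (@closed_eq _ 0)) => x _.
  by apply: simplex_min_continuous => k; exact: bary_continuous.
- have [j x_only] := only_facet x; exists j => i /x_only/eqP.
  by rewrite -coord_min_eq0 => /eqP.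
- apply: (@eq_in_within_continuous _ _ _ _ (fun x => lift j (facet_sphere j x))).
    move=> x x_only; rewrite (@qE j)// => i ij; apply/eqP.
    by rewrite -coord_min_eq0; apply/eqP; exact: x_only.
  apply: comp_continuous (@facet_sphere_continuous j) _.
  exact: (@wedge_lift_continuous _ (fun _ : 'I_#|T| => sphere_d) (fun=> pt) j).
Qed.

Let notin_facets x : supp (bary x) \notin T <-> forall j, supp (bary x) <> facet j.
Proof.
split=> [xT j xj|x_only]; first by move: xT; rewrite xj facetP.
apply/negP => xT; apply: (x_only (enum_rank_in xT (supp (bary x)))).
by rewrite /facet enum_rankK_in.
Qed.

Let q_fibre x x' : q x = q x' <->
  x = x' \/ supp (bary x) \notin T /\ supp (bary x') \notin T.
Proof.
split=> [qxx'|[->//|[/notin_facets xT /notin_facets x'T]]]; last first.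
  rewrite !(@qE j0)//; congr lift; rewrite (facet_sphere_pt _ x).2//.
  by rewrite (facet_sphere_pt _ x').2.
have same_sphere j : facet_sphere j x = facet_sphere j x' by rewrite -!proj_q qxx'.
have same_facet j : supp (bary x) = facet j <-> supp (bary x') = facet j.
  by apply/iff_not2; rewrite -!facet_sphere_pt same_sphere.
have [[j xj]|none] := pselect (exists j, supp (bary x) = facet j); last first.
  right; split; apply/notin_facets => j; last move/same_facet.
    by move=> xj; apply: none; exists j.
  by move=> xj; apply: none; exists j.
left; have x'j := (same_facet j).1 xj.
have same_coord : coord j x =1 coord j x'.
  apply: simplex_sphere_inj; rewrite ?coord_min_gt0 ?coord_sum ?xj ?x'j//.
  exact: (congr1 set_val (same_sphere j)).
apply: bary_inj => v; have [|vj] := boolP (v \in facet j).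
  by rewrite -corner_imset => /imsetP[k _ ->]; exact: same_coord.
have zero z : supp (bary z) = facet j -> bary z v = 0.
  by move=> zj; move: vj; rewrite -zj mem_supp negbK => /eqP.
by rewrite !zero.
Qed.

Let open_facet_point j (a : 'I_d.+1 -> R) : 0 < simplex_min a -> \sum_k a k = 1 ->
  exists x, supp (bary x) = facet j /\ coord j x =1 a.
Proof.
move=> a_min a1; have a_pos k : 0 < a k by exact: lt_le_trans (simplex_min_le a k).
pose F v := \sum_(k | corner j k == v) a k.
have F_corner k : F (corner j k) = a k.
  by rewrite /F (bigD1 k)//= big1 ?addr0// => l /andP[/eqP/corner_inj ->]; rewrite eqxx.
have F_supp : supp F = facet j.
  apply/setP => v; rewrite mem_supp -corner_imset; apply/idP/imsetP => [|[k _ ->]].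
    rewrite psumr_neq0 => [/hasP[k _ /andP[/eqP kv _]]|k _]; last exact: ltW.
    by exists k.
  by rewrite F_corner gt_eqF.
have F_in : realization_set K F.
  split=> [v||]; first by apply: sumr_ge0 => k _; exact: ltW.
    by rewrite -a1 [RHS](partition_big (corner j) xpredT).
  by rewrite -[[set v | _]%SET]/(supp F) F_supp; have [] := facetT (facetP j).
by exists (SigSub (mem_set F_in)); split => // k; exact: F_corner.
Qed.

Let q_surj w : (exists x, supp (bary x) \notin T) -> exists x, q x = w.
Proof.
move=> [x xT]; have : [set: W] w by [].
rewrite -(@wedgeTE _ (fun _ : 'I_#|T| => sphere_d) (fun=> pt)) => -[j _ [y _ <-]].
have [->|y_pt] := eqVneq y pt.
  exists x; move/notin_facets: xT => xT; rewrite (@qE j)//.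
  by rewrite (facet_sphere_pt j x).2.
have [||a [a_min a1 ay]] := @simplex_sphere_surj R d (set_val y).
- exact: set_valP.
- by apply: contra_neq y_pt => e; exact: val_inj.
have [x' [x'j /funext x'a]] := open_facet_point j a_min a1; exists x'.
rewrite (@qE j) => [|i ij]; last by rewrite x'j => /enum_val_inj/esym/eqP; apply/negP.
by congr lift; apply: val_inj; rewrite /= x'a.
Qed.

Theorem facet_deletion_wedge : contractible R (realization R (K :\: T)) ->
  homotopy_equivalent R X W.
Proof.
move=> A_contractible; have [a0 _] := A_contractible.
have [e id_e [x0 eE]] := facet_deletion_deformation downK facetT A_contractible.
apply: (quotient_homotopy_equivalent _ _ q_continuous _ q_fibre id_e).
- exact: realization_compact.
- by apply: wedge_hausdorff => _; apply: set_type_hausdorff; exact: norm_hausdorff.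
- by move=> w; apply: q_surj; exact: (facet_deletion_point a0).
- by move=> x x' xT x'T; rewrite !eE.
Qed.

End FacetDeletionWedge.

(** * Wedge decomposition of a union of two cones *)

Section SuspensionFacets.
Context {V : finType} (M E : {set {set V}}) (d : nat).
Hypotheses (downM : downclosed M) (facetE : facet_family M E d).
Implicit Types (s : {set V + bool}) (t : bool).

Definition apex_facet (e : {set V}) : {set V + bool} := inr true |: inl @: e.

Lemma base_part_apex_facet e : base_part (apex_facet e) = e.
Proof.
by rewrite base_partU base_part_inr base_part_inl finset.set0U.
Qed.

Lemma inr_apex_facet e t : (inr t \in apex_facet e) = t.
Proof.
by rewrite in_setU1 inr_imset_inl orbF; case: t.
Qed.

Lemma eq_base_part s s' : base_part s = base_part s' ->
  (forall t, (inr t \in s) = (inr t \in s')) -> s = s'.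
Proof. by move=> /setP ss' tt'; apply/setP => -[v|//]; have := ss' v; rewrite !inE. Qed.

Lemma apex_facet_suspension s e : s \in suspension M -> inr true \in s ->
  base_part s = e -> s = apex_facet e.
Proof.
move=> /suspensionP[_ apex] st se; apply: eq_base_part => [|t].
  by rewrite base_part_apex_facet.
by rewrite inr_apex_facet; case: t => //; apply/negbTE/(apex true).
Qed.

Lemma apex_facet_family :
  facet_family (suspension M) [set apex_facet e | e in E]%SET d.+1.
Proof.
move=> _ /imsetP[e eE ->]; have [eM ecard e_max] := facetE eE; split.
- apply/suspensionP; rewrite base_part_apex_facet; split=> // t.
  by rewrite !inr_apex_facet negbK.
- by rewrite cardsU1 inr_imset_inl card_imset ?ecard// => u w [].
- move=> s sM es; have /suspensionP[sM' _] := sM.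
  apply: apex_facet_suspension => //.
    by apply: (fintype.subsetP es); rewrite inr_apex_facet.
  by apply: e_max => //; rewrite -[e]base_part_apex_facet; exact: base_partS.
Qed.

Lemma card_apex_facets : #|[set apex_facet e | e in E]%SET| = #|E|.
Proof. by rewrite card_imset//; exact: can_inj base_part_apex_facet. Qed.

(* Without the facets through the apex [true], the suspension is still a union of
   two cones, over [M :\: E] and over [M]. *)
Definition punctured_cone t : {set {set V + bool}} :=
  [set s : {set V + bool} | (base_part s \in (if t then M :\: E else M))
     && (inr (~~ t) \notin s)]%SET.

Lemma punctured_coneP t s :
  reflect (base_part s \in (if t then M :\: E else M) /\ inr (~~ t) \notin s)
    (s \in punctured_cone t).
Proof. by rewrite inE; exact: andP. Qed.

Lemma punctured_cone_pair : (finset.set0 : {set V}) \in M :\: E ->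
  cone_pair punctured_cone (fun t => [set inr t]%SET).
Proof.
move=> E0; have M0 : (finset.set0 : {set V}) \in M by move: E0; rewrite inE => /andP[].
move=> t; split.
- move=> s s' /punctured_coneP[s'M s't] ss'; apply/punctured_coneP; split.
    case: t s'M {s't} => s'M; last exact: downM s'M (base_partS ss').
    exact: (facet_deletion_downclosed downM facetE) s'M (base_partS ss').
  by apply: contra s't; exact: (fintype.subsetP ss').
- by apply/punctured_coneP; rewrite base_part0 finset.in_set0; case: t.
- move=> s /punctured_coneP[sM st]; apply/punctured_coneP; split.
    by rewrite base_partU base_part_inr finset.setU0.
  by rewrite !inE negb_or st /=; case: t {sM st}.
- by apply/punctured_coneP => -[_]; rewrite negbK finset.in_set1 eqxx.
Qed.

Lemma punctured_cone_union :
  punctured_cone true :|: punctured_cone false =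
  suspension M :\: [set apex_facet e | e in E]%SET.
Proof.
apply/setP => s; apply/finset.setUP/finset.setDP.
  move=> [/punctured_coneP[/finset.setDP[sM sE] sf]|/punctured_coneP[sM st]].
    split; first by apply/suspensionP; split=> // -[] // st; move: st (sf) => ->.
    by apply: contra sE => /imsetP[e eE ->]; rewrite base_part_apex_facet.
  split; first by apply/suspensionP; split=> // -[] // /(negP st).
  by apply: contra st => /imsetP[e _ ->]; rewrite inr_apex_facet.
move=> [sM sE]; have /suspensionP[sM' apex] := sM.
have [st|st] := boolP (inr true \in s); last by right; apply/punctured_coneP.
left; apply/punctured_coneP; split; last exact: apex st.
rewrite inE sM' andbT; apply: contra sE => sE; apply/imsetP; exists (base_part s) => //.
exact: apex_facet_suspension.
Qed.

Lemma punctured_cone_cap s :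
  s \in punctured_cone true :&: punctured_cone false ->
  base_part s \in M :\: E /\ forall t, inr t \notin s.
Proof.
by move=> /finset.setIP[/punctured_coneP[sE sf] /punctured_coneP[_ st]]; split=> // -[].
Qed.

End SuspensionFacets.

Section ConePairWedge.
Context {R : realType} {V : finType} (L : bool -> {set {set V}}) (F : bool -> {set V}).
Context (E : {set {set V}}) (d : nat) (phi : V -> V) (q : V).
Notation M := (L true :&: L false).
Hypothesis LF : cone_pair L F.
Hypotheses (facetE : facet_family M E d.+1) (E_gt0 : (0 < #|E|)%N).
Hypothesis id_phi : forall s : {set V}, s \in M :\: E -> s :|: phi @: s \in M :\: E.
Hypothesis phi_q : forall s : {set V}, s \in M :\: E -> q |: phi @: s \in M :\: E.

Let downM : downclosed M. Proof. exact: cone_pair_cap_downclosed LF. Qed.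

Let set0_notin : (finset.set0 : {set V}) \in M :\: E.
Proof.
rewrite inE (cone_pair_cap0 LF) andbT; apply/negP => /facetE[_].
by rewrite cards0.
Qed.

Let punctured_suspension_contractible :
  contractible R (realization R (suspension M :\: [set apex_facet e | e in E]%SET)).
Proof.
rewrite -punctured_cone_union.
pose psi (v : V + bool) : V + bool := if v is inl u then inl (phi u) else v.
have psi_base (s : {set V + bool}) : (forall t, inr t \notin s) ->
    psi @: s = inl @: (phi @: base_part s).
  move=> s_base; apply/setP => -[u|t].
    apply/imsetP/imsetP => [[[v|t] vs // [->]]|[_ /imsetP[v vs ->] [->]]].
      by exists (phi v) => //; apply: imset_f; rewrite mem_base_part.
    by exists (inl v); rewrite -?mem_base_part.
  rewrite inr_imset_inl; apply/imsetP => -[[//|r] /= rs _].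
  by have := s_base r; rewrite rs.
have cone := punctured_cone_pair downM facetE set0_notin.
have in_cap (s : {set V}) : s \in M :\: E ->
    inl @: s \in punctured_cone M E true :&: punctured_cone M E false.
  move=> sE; have sM : s \in M by move: sE => /finset.setDP[].
  by rewrite inE; apply/andP; split; apply/punctured_coneP;
     rewrite base_part_inl inr_imset_inl.
have base_eq (s : {set V + bool}) : (forall t, inr t \notin s) -> s = inl @: base_part s.
  move=> s_base; apply: eq_base_part => [|t]; first by rewrite base_part_inl.
  by rewrite inr_imset_inl; apply/negbTE.
apply: (cone_pair_contractible cone (phi := psi) (q := inl q)) => s.
- move=> /punctured_cone_cap[sE s_base].
  by rewrite psi_base// [X in X :|: _]base_eq// -imsetU in_cap// id_phi.
- move=> /punctured_cone_cap[sE s_base].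
  by rewrite psi_base// -imset_set1 -imsetU in_cap// phi_q.
Qed.

Theorem cone_pair_wedge :
  homotopy_equivalent R (realization R (L true :|: L false))
    (wedge_of_spheres R d.+1 #|E|).
Proof.
apply: homotopy_equivalent_trans (cone_pair_suspension LF) _.
rewrite -(card_apex_facets E); apply: (@facet_deletion_wedge _ _ _ _ d.+1).
- exact: suspension_downclosed.
- exact: apex_facet_family.
- by rewrite card_apex_facets.
- exact: punctured_suspension_contractible.
Qed.

End ConePairWedge.

(** * Clique complexes *)

Section CliqueComplex.
Context {V : finType}.
Implicit Types (r : rel V) (s : {set V}).

Definition clique_complex r : {set {set V}} :=
  [set s : {set V} | [forall u in s, forall v in s, r u v]]%SET.

Lemma clique_complexP r s :
  reflect {in s &, forall u v, r u v} (s \in clique_complex r).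
Proof.
rewrite inE; apply: (iffP forall_inP) => [sr u v us|sr u us].
  by move/forall_inP: (sr u us); exact.
by apply/forall_inP => v vs; exact: sr.
Qed.

Lemma clique_complex_downclosed r : downclosed (clique_complex r).
Proof.
move=> s s' /clique_complexP s'r /fintype.subsetP ss'.
by apply/clique_complexP => u v /ss' us' /ss' vs'; exact: s'r.
Qed.

Lemma clique_cone_pair (r : bool -> rel V) (F : bool -> {set V}) :
  (forall t u v, v \in F t -> r t u v && r t v u) ->
  (forall t, exists u v, [/\ u \in F t, v \in F t & ~~ r (~~ t) u v]) ->
  cone_pair (fun t => clique_complex (r t)) F.
Proof.
move=> rF Fr t; split; first exact: clique_complex_downclosed.
- by apply/clique_complexP => u v; rewrite finset.in_set0.
- move=> s /clique_complexP sr; apply/clique_complexP => u v.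
  move=> /finset.setUP[us|uF]; last by have /andP[] := rF t v u uF.
  by move=> /finset.setUP[vs|vF]; [exact: sr|have /andP[] := rF t u v vF].
- have [u [v [uF vF ruv]]] := Fr t; apply/clique_complexP => Fr'.
  by rewrite Fr' in ruv.
Qed.

Lemma clique_complex_imset r (phi : V -> V) s : s \in clique_complex r ->
  (forall u v, r u v -> [&& r u (phi v), r (phi u) v & r (phi u) (phi v)]) ->
  s :|: phi @: s \in clique_complex r.
Proof.
move=> /clique_complexP sr rphi; apply/clique_complexP => u v.
move=> /finset.setUP[us|/imsetP[u' u's ->]] /finset.setUP[vs|/imsetP[v' v's ->]].
- exact: sr.
- by have /and3P[] := rphi _ _ (sr _ _ us v's).
- by have /and3P[] := rphi _ _ (sr _ _ u's vs).
- by have /and3P[] := rphi _ _ (sr _ _ u's v's).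
Qed.

(* [D] orients each edge from the colour [true] to the colour [false]. *)
Section MaximalEdges.
Context (r : rel V) (col : V -> bool) (D : {set V * V}).
Hypothesis D_col : forall p, p \in D -> col p.1 && ~~ col p.2.
Hypothesis D_max : forall p u, p \in D -> r u p.1 -> r u p.2 -> u \in [set p.1; p.2]%SET.
Hypothesis D_clique : forall p, p \in D -> [set p.1; p.2]%SET \in clique_complex r.

Definition edge_set : {set {set V}} := [set [set p.1; p.2] | p in D]%SET.

Lemma edge_facet_family : facet_family (clique_complex r) edge_set 2.
Proof.
move=> _ /imsetP[p pD ->]; split; first exact: D_clique.
  rewrite cards2; suff -> : p.1 != p.2 by [].
  by apply: contraTneq (D_col pD) => ->; rewrite andbN.
move=> s /clique_complexP sr ps; apply/eqP; rewrite finset.eqEsubset ps andbT.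
have [p1s p2s] : p.1 \in s /\ p.2 \in s.
  by split; apply: (fintype.subsetP ps); rewrite !inE eqxx ?orbT.
by apply/fintype.subsetP => u us; apply: D_max => //; exact: sr.
Qed.

Lemma card_edge_set : #|edge_set| = #|D|.
Proof.
rewrite card_in_imset// => -[a b] [a' b'] pD p'D /= /setP ab.
have /andP[/= ca cb] := D_col pD; have /andP[/= ca' cb'] := D_col p'D.
congr pair; apply/eqP.
  have := ab a; rewrite !inE eqxx /= => /esym/orP[//|/eqP e].
  by rewrite -e ca in cb'.
have := ab b; rewrite !inE eqxx orbT /= => /esym/orP[/eqP e|//].
by rewrite e ca' in cb.
Qed.

Lemma clique_complexD_edge_set : clique_complex r :\: edge_set =
  clique_complex (fun u v => [&& r u v, (u, v) \notin D & (v, u) \notin D]).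
Proof.
apply/setP => s; apply/finset.setDP/clique_complexP => [[sr sE] u v us vs|sr].
  have edge_notin a b : a \in s -> b \in s -> (a, b) \notin D.
    move=> sa sb; apply: contra sE => abD.
    have abE : [set a; b]%SET \in edge_set.
      exact: (imset_f (fun p => [set p.1; p.2]%SET) abD).
    have [_ _ ab_max] := edge_facet_family abE; rewrite (ab_max s)//.
    by apply/fintype.subsetP => w; rewrite !inE => /orP[] /eqP ->.
  by rewrite (clique_complexP _ _ sr)//= !edge_notin.
split; first by apply/clique_complexP => u v us vs; have /andP[] := sr _ _ us vs.
apply/negP => /imsetP[p pD sE]; have := sr p.1 p.2; rewrite sE !inE !eqxx orbT.
by rewrite -surjective_pairing pD andbF => /(_ isT isT).
Qed.

Lemma edge_deletion_wedge (R : realType) (c : bool -> rel V) (F : bool -> {set V})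
    (core : rel V) (phi : V -> V) (q : V) :
  cone_pair (fun t => clique_complex (c t)) F ->
  clique_complex (c true) :&: clique_complex (c false) = clique_complex r ->
  (forall u v, [&& r u v, (u, v) \notin D & (v, u) \notin D] = core u v) ->
  (forall u v, core u v ->
    [&& core u (phi v), core (phi u) v & core (phi u) (phi v)]) ->
  q |: phi @: V \in clique_complex core -> (0 < #|D|)%N ->
  homotopy_equivalent R
    (realization R (clique_complex (c true) :|: clique_complex (c false)))
    (wedge_of_spheres R 2 #|D|).
Proof.
move=> cF capE coreE core_phi phi_q D0.
have capD : clique_complex (c true) :&: clique_complex (c false) :\: edge_set =
    clique_complex core.
  rewrite capE clique_complexD_edge_set; congr clique_complex.
  by apply/funext => u; apply/funext => v.
rewrite -card_edge_set; apply: (cone_pair_wedge (phi := phi) (q := q) cF).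
- by rewrite capE; exact: edge_facet_family.
- by rewrite card_edge_set.
- by move=> s; rewrite capD => /clique_complex_imset; exact.
- move=> s _; rewrite capD; apply: clique_complex_downclosed phi_q _.
  by apply: finset.setUS; apply: imsetS; exact/fintype.subsetP.
Qed.

End MaximalEdges.

End CliqueComplex.

(** * Total cut complexes *)

Section TotalCutComplex.
Context {V : finType} (e : rel V) (k : nat).
Implicit Types s S : {set V}.

Lemma independentP S : reflect {in S &, forall u v, ~~ e u v} (independent e S).
Proof.
apply: (iffP forall_inP) => [indep u v us|indep u us].
  by move/forall_inP: (indep u us); exact.
by apply/forall_inP => v vs; exact: indep.
Qed.

Lemma total_cut_complexP s :
  reflect (exists S, [/\ independent e S, #|S| = k & s \subset ~: S])
          (s \in total_cut_complex e k).
Proof.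
rewrite inE; apply: (iffP exists_inP) => [[_ /imsetP[S + ->] sS]|[S [indep cS sS]]].
  by rewrite inE => /andP[indep /eqP cS]; exists S.
by exists (~: S) => //; apply: imset_f; rewrite inE indep cS eqxx.
Qed.

Lemma complex_dim_total_cut : (exists S, independent e S /\ #|S| = k) ->
  complex_dim (total_cut_complex e k) = (#|V| - k).-1.
Proof.
have card_cut S : #|S| = k -> #|~: S| = (#|V| - k)%N.
  by move=> cS; rewrite cardsCs finset.setCK cS.
move=> [S [indep cS]]; congr _.-1; apply/eqP; rewrite eqn_leq; apply/andP; split.
  apply/bigmax_leqP => s /total_cut_complexP[S' [_ cS' sS']].
  by rewrite -(card_cut _ cS') subset_leq_card.
rewrite -(card_cut _ cS); apply: (leq_bigmax_cond (F := fun s : {set V} => #|s|)).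
by apply/total_cut_complexP; exists S.
Qed.

End TotalCutComplex.

(** * Total cuts of the circular ladder *)

Section CircularLadder.
Context (p : nat).
Notation n := p.+1.
Notation V := ('I_n * bool)%type.
Notation ladder := (@circular_ladder n).
Implicit Types (i j : 'I_n) (t : bool) (u v : V).

Lemma iter_ordS d i : iter d (@ordS n) i = ((i + d) %% n)%N :> nat.
Proof.
elim: d => [|d IH] /=; first by rewrite addn0 modn_small.
by rewrite IH -addn1 modnDml addn1 addnS.
Qed.

Lemma ordS_invariant (T : Type) (f : 'I_n -> T) i :
  (forall j, j != i -> ordS j != i -> f (ordS j) = f j) ->
  forall j, j != i -> f j = f (ordS i).
Proof.
move=> f_ordS j ji; have iter_neq d : (0 < d < n)%N -> iter d (@ordS n) i != i.
  move=> /andP[d0 dn]; rewrite -val_eqE /= iter_ordS.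
  rewrite -{2}(modn_small (ltn_ord i)) -[X in _ != X %[mod _]]addn0 eqn_modDl.
  by rewrite mod0n modn_small// -lt0n.
have f_iter d : (d.+1 < n)%N -> f (iter d.+1 (@ordS n) i) = f (ordS i).
  elim: d => [//|d IH] dn; rewrite -IH; last exact: ltnW.
  apply: (f_ordS (iter d.+1 (@ordS n) i)); first exact: (iter_neq d.+1 (ltnW dn)).
  exact: (iter_neq d.+2 dn).
pose d := ((n - i + j) %% n)%N; have dn : (d < n)%N by exact: ltn_pmod.
have jE : iter d (@ordS n) i = j.
  apply: val_inj; rewrite /= iter_ordS /d modnDmr addnA subnKC ?modnDl ?modn_small//.
  exact: ltnW.
case: d dn jE => [|d] dn jE; last by rewrite -jE f_iter.
by rewrite -jE eqxx in ji.
Qed.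

(* For odd n the two ladder sides cannot alternate all the way around, and the
   defect is put on the omitted rung [i]. *)
Definition twist i j : bool := odd j (+) (odd n && (i < j)%N).

Lemma twist_ordS i j : j != i -> ordS j != i -> twist i (ordS j) = ~~ twist i j.
Proof.
rewrite /twist -!val_eqE /=; have [jp|jp] := eqVneq (j : nat) p.
  rewrite jp modnn /= => pi _; have -> : (i < p)%N.
    by rewrite ltn_neqAle eq_sym pi -ltnS ltn_ord.
  by rewrite andbT; case: (odd p).
have jp' : (j.+1 < n)%N by rewrite ltnS ltn_neqAle jp -ltnS ltn_ord.
by rewrite modn_small//= => ji _; rewrite ltnS leq_eqVlt eq_sym (negbTE ji) addNb.
Qed.

Definition alternating_set i t : {set V} :=
  [set u : V | (u.1 != i) && (u.2 == t (+) twist i u.1)]%SET.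

Lemma card_alternating_set i t : #|alternating_set i t| = p.
Proof.
have -> : alternating_set i t = (fun j => (j, t (+) twist i j)) @: (~: [set i]).
  apply/setP => -[j s]; rewrite inE /=.
  apply/andP/imsetP => [[ji /eqP ->]|[k + [-> ->]]].
    by exists j => //; rewrite !inE.
  by rewrite !inE.
by rewrite card_imset ?cardsC1 ?card_ord// => j k [].
Qed.

Lemma independent_alternating_set i t : independent ladder (alternating_set i t).
Proof.
apply/independentP => -[j s] [k r]; rewrite !inE /= /circular_ladder /=.
move=> /andP[ji /eqP ->] /andP[ki /eqP ->].
have side_neq l : l != i -> ordS l != i -> t (+) twist i l != t (+) twist i (ordS l).
  by move=> li Sli; rewrite twist_ordS//; case: t; case: (twist i l).
apply/negP => /orP[/andP[sr /orP[/eqP kE|/eqP jE]]|/andP[/eqP -> ]].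
- by have := side_neq j ji; rewrite -kE ki sr => /(_ isT).
- by have := side_neq k ki; rewrite -jE ji eq_sym sr => /(_ isT).
- by rewrite eqxx.
Qed.

Lemma independent_rung_inj (S : {set V}) : independent ladder S ->
  {in S &, injective fst}.
Proof.
move=> /independentP indep [j s] [k r] us vs /= jk; rewrite -{k}jk in vs *.
have := indep _ _ us vs; rewrite /circular_ladder /= eqxx /= negb_or negbK.
by move=> /andP[_ /eqP ->].
Qed.

Lemma independent_alternating_setE (S : {set V}) :
  independent ladder S -> #|S| = p -> exists i t, S = alternating_set i t.
Proof.
move=> indep cardS; have rung_inj := independent_rung_inj indep.
have [i rungs] : exists i, fst @: S = ~: [set i]%SET.
  have /cards1P[i iE] : #|~: (fst @: S)| == 1%N.
    by rewrite cardsCs finset.setCK card_in_imset// cardS card_ord subSnn.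
  by exists i; rewrite -iE finset.setCK.
pose chosen j := (j, true) \in S.
have memS j s : ((j, s) \in S) = (j != i) && (s == chosen j).
  have -> : (j != i) = (j \in fst @: S) by rewrite rungs !inE.
  apply/idP/andP => [js|[/imsetP[[k r] kS /= jk] /eqP ->]].
    split; first exact: (imset_f fst js).
    rewrite /chosen; case: s js => js; first by rewrite js.
    by rewrite eq_sym eqbF_neg; apply/negP => jt; have [] := rung_inj _ _ js jt erefl.
  rewrite -{k}jk in kS; case: r kS => jS; rewrite /chosen ?jS//.
  by case: (boolP ((j, true) \in S)).
have invariant j : j != i -> ordS j != i ->
    chosen (ordS j) (+) twist i (ordS j) = chosen j (+) twist i j.
  move=> ji Sji; have : chosen (ordS j) != chosen j.
    apply/negP => /eqP same.
    move/independentP: indep => /(_ (j, chosen j) (ordS j, chosen (ordS j))).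
    by rewrite !memS ji Sji !eqxx /circular_ladder /= same !eqxx => /(_ isT isT).
  rewrite twist_ordS//.
  by case: (chosen (ordS j)); case: (chosen j); case: (twist i j).
exists i, (chosen (ordS i) (+) twist i (ordS i)); apply/setP => -[j s].
rewrite memS inE /=; case: eqVneq => //= ji.
by rewrite -(ordS_invariant invariant ji) -addbA addbb addbF.
Qed.

(* This separates the two sequences of vertices that alternate between + and -
   along the ladder. *)
Definition side u : bool := u.2 (+) odd u.1.

Definition rail t j : V := (j, t (+) odd j).

Lemma side_rail t j : side (rail t j) = t.
Proof. by rewrite /side -addbA addbb addbF. Qed.

Lemma rail_side u : rail (side u) u.1 = u.
Proof. by case: u => j s; rewrite /rail /side /= -addbA addbb addbF. Qed.

Lemma eq_side u v : side u = side v -> u.1 = v.1 -> u = v.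
Proof. by move=> s r; rewrite -[u]rail_side -[v]rail_side s r. Qed.

Lemma ladder_cutP (s : {set V}) :
  reflect (exists i t, forall u, u \in s -> u.1 != i ->
             side u = t (+) (odd n && (i < u.1)%N))
          (s \in total_cut_complex ladder p).
Proof.
have off_alternating i t u : u.1 != i ->
    (u \in ~: alternating_set i t) = (side u == ~~ t (+) (odd n && (i < u.1)%N)).
  move=> ui; rewrite !inE ui /side /twist /=.
  by case: u.2; case: (odd u.1); case: t; case: (odd n && _).
apply: (iffP (total_cut_complexP _ _ _)) => [[S [indep cardS sS]]|[i [t s_side]]].
  have [i [t SE]] := independent_alternating_setE indep cardS.
  exists i, (~~ t) => u us ui; apply/eqP; rewrite -off_alternating//.
  by rewrite -SE; exact: (fintype.subsetP sS).
exists (alternating_set i (~~ t)); split.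
- exact: independent_alternating_set.
- exact: card_alternating_set.
- apply/fintype.subsetP => u us; have [ui|ui] := eqVneq u.1 i.
    by rewrite !inE ui eqxx.
  by rewrite off_alternating// negbK; apply/eqP/s_side.
Qed.

Lemma ladder_cut_dim : complex_dim (total_cut_complex ladder p) = n.
Proof.
rewrite complex_dim_total_cut; last first.
  exists (alternating_set ord0 true).
  by split; [exact: independent_alternating_set|exact: card_alternating_set].
by rewrite card_prod card_ord card_bool muln2 -addnn -{1}addn1 -addnA addKn.
Qed.

Definition even_cone_rel t : rel V :=
  fun u v => (side u == ~~ t) && (side v == ~~ t) ==> (u == v).

Definition odd_cone_rel t : rel V :=
  fun u v => (side u == ~~ t) && (side v == t) ==> (v.1 <= u.1)%N.

Lemma ladder_cut_union_clique (r : bool -> rel V) :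
  (forall s, s \in total_cut_complex ladder p <-> exists t, s \in clique_complex (r t)) ->
  total_cut_complex ladder p = clique_complex (r true) :|: clique_complex (r false).
Proof.
move=> cutE; apply/setP => s; apply/idP/finset.setUP.
  by move=> /cutE[[] ?]; [left|right].
by move=> [] sr; apply/cutE; [exists true|exists false].
Qed.

Lemma ladder_cut_even : ~~ odd n -> total_cut_complex ladder p =
  clique_complex (even_cone_rel true) :|: clique_complex (even_cone_rel false).
Proof.
move=> /negbTE n_even; apply: ladder_cut_union_clique => s; split.
  move=> /ladder_cutP[i [t s_side]]; exists t; apply/clique_complexP => u v us vs.
  apply/implyP => /andP[/eqP ut /eqP vt].
  have on_i w : w \in s -> side w = ~~ t -> w.1 = i.
    move=> ws wt; apply/eqP; apply: contraT => wi.
    by have := s_side w ws wi; rewrite n_even addbF wt; case: (t).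
  by apply/eqP/eq_side; rewrite ?ut ?vt// !on_i.
move=> [t /clique_complexP s_cone]; apply/ladder_cutP.
have [i iP] : exists i, forall u, u \in s -> side u = ~~ t -> u.1 = i.
  have [[w [ws wt]]|none] := pselect (exists w, w \in s /\ side w = ~~ t).
    exists w.1 => u us ut; have := s_cone u w us ws.
    by rewrite /even_cone_rel ut wt eqxx => /eqP ->.
  by exists ord0 => u us ut; case: none; exists u.
exists i, t => u us; rewrite n_even addbF; apply: contra_neq_eq => ut.
by apply: iP => //; case: (side u) ut; case: (t).
Qed.

Lemma ladder_cut_odd : odd n -> total_cut_complex ladder p =
  clique_complex (odd_cone_rel true) :|: clique_complex (odd_cone_rel false).
Proof.
move=> n_odd; apply: ladder_cut_union_clique => s; split.
  move=> /ladder_cutP[i [t s_side]]; exists t; apply/clique_complexP => u v us vs.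
  apply/implyP => /andP[/eqP ut /eqP vt]; apply: (@leq_trans i); rewrite leqNgt.
    apply/negP => iv; have vi : v.1 != i by rewrite -val_eqE /= gtn_eqF.
    by have := s_side v vs vi; rewrite n_odd iv vt; case: (t).
  apply/negP => ui; have ui' : u.1 != i by rewrite -val_eqE /= ltn_eqF.
  by have := s_side u us ui'; rewrite n_odd ltnNge (ltnW ui) ut; case: (t).
move=> [t /clique_complexP s_cone]; apply/ladder_cutP.
have [i [below above]] : exists i,
    (forall v, v \in s -> side v = t -> (v.1 <= i)%N) /\
    (forall u, u \in s -> side u = ~~ t -> (i <= u.1)%N).
  have [[w wP]|none] := pselect (exists w, (w \in s) && (side w == t)).
    case: (@arg_maxnP _ w (fun v => (v \in s) && (side v == t)) (fun v => v.1 : nat) wP).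
    move=> v /andP[vs vt] v_max; exists v.1; split=> u us ut.
      by apply: v_max; rewrite us ut /=.
    by have := s_cone u v us vs; rewrite /odd_cone_rel ut vt eqxx.
  exists ord0; split=> // v vs vt; case: none; exists v.
  by rewrite vs vt eqxx.
exists i, t => u us ui; rewrite n_odd.
have [iu|ui'] := ltnP i u.1.
  apply: contraTeq iu => ut; rewrite -leqNgt; apply: below => //.
  by case: (side u) ut; case: (t).
have {}ui' : (u.1 < i)%N by rewrite ltn_neqAle ui'; rewrite -val_eqE in ui; rewrite ui.
apply: contraTeq ui' => ut; rewrite -leqNgt; apply: above => //.
by case: (side u) ut; case: (t).
Qed.

Hypothesis p_gt0 : (0 < p)%N.

Let ord_max_neq0 : ord_max != ord0 :> 'I_n.
Proof. by rewrite -val_eqE /= -lt0n. Qed.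

Lemma even_cone_pair : cone_pair (fun t => clique_complex (even_cone_rel t))
  (fun t => [set u | side u == t]%SET).
Proof.
apply: clique_cone_pair => [t u v|t].
  by rewrite inE /even_cone_rel => /eqP ->; case: t; rewrite !andbF.
exists (rail t ord0), (rail t ord_max); rewrite !inE !side_rail /even_cone_rel !side_rail.
by rewrite negbK eqxx /= xpair_eqE eq_sym (negbTE ord_max_neq0).
Qed.

Lemma odd_cone_pair : cone_pair (fun t => clique_complex (odd_cone_rel t))
  (fun t => [set rail (~~ t) ord_max; rail t ord0]%SET).
Proof.
apply: clique_cone_pair => [t u v|t].
  rewrite !inE /odd_cone_rel => /orP[] /eqP ->; rewrite side_rail /=.
    by rewrite leq_ord implybT; case: t; rewrite andbF.
  by rewrite implybT; case: t.
exists (rail t ord0), (rail (~~ t) ord_max); rewrite !inE !eqxx orbT.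
by rewrite /odd_cone_rel !side_rail negbK !eqxx /= -ltnNge.
Qed.

Definition even_cap_rel : rel V := fun u v => (side u == side v) ==> (u == v).

Definition odd_cap_rel : rel V := fun u v => (side u != side v) ==> (u.1 == v.1).

Lemma even_cone_cap :
  clique_complex (even_cone_rel true) :&: clique_complex (even_cone_rel false) =
  clique_complex even_cap_rel.
Proof.
apply/setP => s; apply/finset.setIP/clique_complexP => [[]|s_link].
  move=> /clique_complexP st /clique_complexP sf u v us vs.
  have := st u v us vs; have := sf u v us vs; rewrite /even_cone_rel /even_cap_rel.
  by case: (side u); case: (side v).
by split; apply/clique_complexP => u v us vs; have := s_link u v us vs;
  rewrite /even_cone_rel /even_cap_rel; case: (side u); case: (side v).
Qed.

Lemma odd_cone_cap :
  clique_complex (odd_cone_rel true) :&: clique_complex (odd_cone_rel false) =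
  clique_complex odd_cap_rel.
Proof.
apply/setP => s; apply/finset.setIP/clique_complexP => [[]|s_link].
  move=> /clique_complexP st /clique_complexP sf u v us vs.
  have := st u v us vs; have := sf u v us vs; have := st v u vs us; have := sf v u vs us.
  rewrite /odd_cone_rel /odd_cap_rel -val_eqE eqn_leq.
  by case: (side u); case: (side v) => //= *; apply/andP.
by split; apply/clique_complexP => u v us vs; have := s_link u v us vs;
  rewrite /odd_cone_rel /odd_cap_rel; case: (side u); case: (side v) => //= /eqP ->.
Qed.

Definition even_edges : {set V * V} :=
  [set w : V * V | [&& side w.1, ~~ side w.2, w.1.1 != ord0 & w.2.1 != ord0]]%SET.

Definition odd_edges : {set V * V} :=
  [set w : V * V | [&& side w.1, ~~ side w.2, w.1.1 == w.2.1 & w.1.1 != ord0]]%SET.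

Lemma card_even_edges : #|even_edges| = (p ^ 2)%N.
Proof.
pose edge (a : 'I_n * 'I_n) := (rail true a.1, rail false a.2).
have -> : even_edges = edge @: finset.setX (~: [set ord0]) (~: [set ord0]).
  apply/setP => -[u v]; rewrite inE /=.
  apply/and4P/imsetP => [[su sv u0 v0]|[[i j] + [-> ->]]].
    exists (u.1, v.1); first by rewrite !inE u0.
    by rewrite -[in LHS](rail_side u) -[in LHS](rail_side v) su (negbTE sv).
  by rewrite !inE /= !side_rail => /andP[].
rewrite card_imset ?cardsX ?cardsC1 ?card_ord ?expnS ?muln1//.
by move=> [i j] [i' j'] [-> _ -> _].
Qed.

Lemma card_odd_edges : #|odd_edges| = p.
Proof.
have -> : odd_edges = (fun i => (rail true i, rail false i)) @: (~: [set ord0]).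
  apply/setP => -[u v]; rewrite inE /=.
  apply/and4P/imsetP => [[su sv /eqP uv u0]|[i + [-> ->]]].
    exists u.1; first by rewrite !inE u0.
    by rewrite -[in LHS](rail_side u) -[in LHS](rail_side v) su (negbTE sv) uv.
  by rewrite !inE /= !side_rail.
by rewrite card_imset ?cardsC1 ?card_ord// => i j [].
Qed.

(* After the deletion, every edge between the two sides meets the rung 0, onto
   which the whole complex retracts. *)
Definition even_core_rel : rel V := fun u v =>
  if side u == side v then u == v else (u.1 == ord0) || (v.1 == ord0).

Definition odd_core_rel : rel V := fun u v =>
  (side u != side v) ==> (u.1 == ord0) && (v.1 == ord0).

Definition even_retract u : V := if u.1 == ord0 then u else rail (~~ side u) ord0.

Definition odd_retract u : V := rail (side u) ord0.

Lemma even_retract_rung0 u : (even_retract u).1 = ord0.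
Proof. by rewrite /even_retract; case: eqP. Qed.

Lemma even_core_rung0 u v : u.1 = ord0 -> v.1 = ord0 -> even_core_rel u v.
Proof.
move=> u0 v0; rewrite /even_core_rel u0 eqxx; case: eqP => // uv.
by apply/eqP/eq_side; rewrite ?u0.
Qed.

Lemma odd_core_rung0 u v : u.1 = ord0 -> v.1 = ord0 -> odd_core_rel u v.
Proof. by move=> u0 v0; rewrite /odd_core_rel u0 v0 eqxx implybT. Qed.

Lemma even_core_sym u v : even_core_rel u v = even_core_rel v u.
Proof. by rewrite /even_core_rel eq_sym [v == u]eq_sym orbC. Qed.

Lemma even_retract_core u v : even_core_rel u v ->
  [&& even_core_rel u (even_retract v), even_core_rel (even_retract u) v
    & even_core_rel (even_retract u) (even_retract v)].
Proof.
move=> uv; rewrite [X in _ && (_ && X)]even_core_rung0 ?even_retract_rung0// andbT.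
have retract0 w : w.1 = ord0 -> even_retract w = w by rewrite /even_retract => ->.
have retractN w : w.1 != ord0 -> even_retract w = rail (~~ side w) ord0.
  by rewrite /even_retract => /negbTE ->.
have retract_eq w z : w.1 = ord0 -> z.1 != ord0 -> even_core_rel w z ->
    even_retract z = w.
  move=> w0 z0; rewrite /even_core_rel; case: eqVneq => [_ /eqP wz|wz _].
    by rewrite -wz w0 eqxx in z0.
  rewrite retractN//; apply: eq_side; rewrite ?side_rail//.
  by case: (side w) (side z) wz => -[].
have [u0|u0] := eqVneq u.1 ord0; have [v0|v0] := eqVneq v.1 ord0.
- by rewrite !retract0// uv.
- by rewrite (retract_eq _ _ u0 v0 uv) retract0// uv even_core_rung0.
- have vu : even_core_rel v u by rewrite even_core_sym.
  by rewrite (retract_eq _ _ v0 u0 vu) retract0// uv even_core_rung0.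
- move: uv; rewrite /even_core_rel; case: eqVneq => [_ /eqP <-|_].
    by rewrite retractN// side_rail; case: (side u); rewrite eqxx ?orbT.
  by rewrite (negbTE u0) (negbTE v0).
Qed.

Lemma odd_retract_core u v : odd_core_rel u v ->
  [&& odd_core_rel u (odd_retract v), odd_core_rel (odd_retract u) v
    & odd_core_rel (odd_retract u) (odd_retract v)].
Proof.
rewrite /odd_core_rel /odd_retract !side_rail /= implybT !andbT.
by case: eqP => //= _ /andP[-> ->].
Qed.

Lemma even_cap_relD_edges u v :
  [&& even_cap_rel u v, (u, v) \notin even_edges & (v, u) \notin even_edges] =
  even_core_rel u v.
Proof.
rewrite /even_cap_rel /even_core_rel !inE /=.
by case: (side u); case: (side v); rewrite //= ?andbT ?andbF ?negb_and ?negbK// orbC.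
Qed.

Lemma odd_cap_relD_edges u v :
  [&& odd_cap_rel u v, (u, v) \notin odd_edges & (v, u) \notin odd_edges] =
  odd_core_rel u v.
Proof.
rewrite /odd_cap_rel /odd_core_rel !inE /=.
have rung0 i j : (i == j) && ~~ ((i == j) && (i != ord0)) = (i == ord0) && (j == ord0).
  have [->|ij] /= := eqVneq i j; first by rewrite andbb negbK.
  by apply/esym/negbTE; apply: contra ij => /andP[/eqP -> /eqP ->].
case: (side u); case: (side v); rewrite //= ?andbT ?rung0//.
by rewrite eq_sym rung0 andbC.
Qed.

Lemma even_edges_sides w : w \in even_edges -> side w.1 && ~~ side w.2.
Proof. by rewrite inE => /and4P[-> ->]. Qed.

Lemma even_edges_maximal w u : w \in even_edges ->
  even_cap_rel u w.1 -> even_cap_rel u w.2 -> u \in [set w.1; w.2]%SET.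
Proof.
move=> /even_edges_sides/andP[s1 /negbTE s2]; rewrite /even_cap_rel s1 s2 !inE.
by case: (side u) => /= [->|_ ->]; rewrite ?orbT.
Qed.

Lemma even_edges_clique w : w \in even_edges ->
  [set w.1; w.2]%SET \in clique_complex even_cap_rel.
Proof.
move=> /even_edges_sides/andP[s1 /negbTE s2]; apply/clique_complexP => u v.
by rewrite !inE /even_cap_rel => /orP[] /eqP -> /orP[] /eqP ->; rewrite ?s1 ?s2 ?eqxx.
Qed.

Lemma odd_edges_sides w : w \in odd_edges -> side w.1 && ~~ side w.2.
Proof. by rewrite inE => /and4P[-> ->]. Qed.

Lemma odd_edges_maximal w u : w \in odd_edges ->
  odd_cap_rel u w.1 -> odd_cap_rel u w.2 -> u \in [set w.1; w.2]%SET.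
Proof.
rewrite inE => /and4P[s1 /negbTE s2 /eqP w12 _]; rewrite /odd_cap_rel s1 s2 !inE.
case us : (side u) => /=.
  move=> _ /eqP u2; suff -> : u = w.1 by rewrite eqxx.
  by apply: eq_side; rewrite ?us ?s1 ?w12.
move=> /eqP u1 _; suff -> : u = w.2 by rewrite eqxx orbT.
by apply: eq_side; rewrite ?us ?s2 -?w12.
Qed.

Lemma odd_edges_clique w : w \in odd_edges ->
  [set w.1; w.2]%SET \in clique_complex odd_cap_rel.
Proof.
rewrite inE => /and4P[_ _ /eqP w12 _]; apply/clique_complexP => u v.
by rewrite !inE => /orP[] /eqP -> /orP[] /eqP ->; apply/implyP => _; rewrite ?w12.
Qed.

Lemma rung0_clique (r : rel V) (phi : V -> V) :
  (forall u v, u.1 = ord0 -> v.1 = ord0 -> r u v) -> (forall u, (phi u).1 = ord0) ->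
  rail true ord0 |: phi @: {: V} \in clique_complex r.
Proof.
move=> r0 phi0; apply/clique_complexP => u v.
have on_rung0 w : w \in rail true ord0 |: phi @: {: V} -> w.1 = ord0.
  by rewrite in_setU1 => /orP[/eqP ->//|/imsetP[w' _ ->]].
by move=> /on_rung0 u0 /on_rung0 v0; exact: r0.
Qed.

Lemma even_wedge (R : realType) : homotopy_equivalent R
  (realization R (clique_complex (even_cone_rel true)
                  :|: clique_complex (even_cone_rel false)))
  (wedge_of_spheres R 2 (p ^ 2)).
Proof.
rewrite -[X in wedge_of_spheres _ _ X]card_even_edges.
apply: (edge_deletion_wedge (q := rail true ord0) even_edges_sides
  even_edges_maximal even_edges_clique R
  even_cone_pair even_cone_cap even_cap_relD_edges even_retract_core).
  exact: rung0_clique even_core_rung0 even_retract_rung0.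
by rewrite card_even_edges expn_gt0 p_gt0.
Qed.

Lemma odd_wedge (R : realType) : homotopy_equivalent R
  (realization R (clique_complex (odd_cone_rel true)
                  :|: clique_complex (odd_cone_rel false)))
  (wedge_of_spheres R 2 p).
Proof.
rewrite -[X in wedge_of_spheres _ _ X]card_odd_edges.
apply: (edge_deletion_wedge (q := rail true ord0) odd_edges_sides
  odd_edges_maximal odd_edges_clique R
  odd_cone_pair odd_cone_cap odd_cap_relD_edges odd_retract_core); last first.
  by rewrite card_odd_edges.
by apply: rung0_clique => //; exact: odd_core_rung0.
Qed.

End CircularLadder.

Theorem theorem4p5 (R : realType) (n : nat) (hn : (3 <= n)%N) :
  let K := total_cut_complex (@circular_ladder n) (n - 1)%N in
  [/\ complex_dim K = n,
      odd n ->
        homotopy_equivalent R (realization R K)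
          (wedge_of_spheres R 2 (n - 1)%N)
    & ~~ odd n ->
        homotopy_equivalent R (realization R K)
          (wedge_of_spheres R 2 ((n - 1) ^ 2)%N)].
Proof.
case: n hn => // p hp; rewrite subn1 /=.
have p_gt0 : (0 < p)%N := ltnW hp.
split; first exact: ladder_cut_dim.
- by move=> n_odd; rewrite ladder_cut_odd//; exact: odd_wedge.
- by move=> n_even; rewrite ladder_cut_even//; exact: even_wedge.
Qed.
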